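(* Let $\lambda$ be a nonempty partition with $\ell(\lambda)<n$ and let $P\in F_{\lambda,n}$. Then $$\left(I_{\mathrm S}(P)^{\langle2\rangle}\right)_\lambda=\left(\widehat T_PF_{\lambda,n}\right)^\perp\subseteq\mathbb{S}_\lambda V^*.$$
   Context: $V$ is a complex vector space of dimension $n$; $G=\mathrm{GL}(V)$. For a partition $\alpha$ with $\ell(\alpha)\le n$, $\mathbb{S}_\alpha V$ is the irreducible polynomial $G$-module of highest weight $\alpha$, $\mathbb{S}_\alpha V^*$ is its dual, and $\alpha'$ is the conjugate partition. Put $\mathbb{S}^\bullet V^*=\bigoplus_{\ell(\alpha)\le n}\mathbb{S}_\alpha V^*$; for a subspace $A\subseteq\mathbb{S}^\bullet V^*$, $(A)_\alpha=A\cap\mathbb{S}_\alpha V^*$. Flag variety. $F_{\lambda,n}\subseteq\mathbb{P}(\mathbb{S}_\lambda V)$ is the unique closed $G$-orbit, i.e. the orbit of the class of a highest-weight vector. $\widehat T_PF_{\lambda,n}\subseteq\mathbb{S}_\lambda V$ is the affine tangent space, i.e. the Zariski tangent space to the affine cone over $F_{\lambda,n}$ at a nonzero representative of $P$. Schur apolarity action. Realize $\mathbb{S}_\alpha V$ (resp. $\mathbb{S}_\alpha V^*$) as the unique $G$-submodule of that isomorphism type in $\bigotimes_{c}\bigwedge^{\alpha'_c}V$ (resp. $\bigotimes_c\bigwedge^{\alpha'_c}V^*$), the column realization. For $\mu\subseteq\lambda$ (put $\mu'_c=0$ for $c>\mu_1$), the action $*:\mathbb{S}_\mu V^*\otimes\mathbb{S}_\lambda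 V\to\mathbb{S}_{\lambda/\mu}V\subseteq\bigotimes_{c=1}^{\lambda_1}\bigwedge^{\lambda'_c-\mu'_c}V$ is the restriction of the tensor product over $c$ of the usual skew-symmetric contractions $\bigwedge^{\mu'_c}V^*\otimes\bigwedge^{\lambda'_c}V\to\bigwedge^{\lambda'_c-\mu'_c}V$; here $\mathbb{S}_{\lambda/\mu}V$ is the skew Schur module. If $\mu\not\subseteq\lambda$ the action is zero. It is extended componentwise to $\mathbb{S}^\bullet V^*\otimes\mathbb{S}_\lambda V\to\bigoplus_{\mu\subseteq\lambda}\mathbb{S}_{\lambda/\mu}V$. The action is $G$-equivariant; for $\mu=\lambda$ it is a perfect pairing $\mathbb{S}_\lambda V^*\otimes\mathbb{S}_\lambda V\to\mathbb{C}$, a nonzero scalar multiple of the evaluation pairing, and for a subspace $U\subseteq\mathbb{S}_\lambda V$ one sets $U^\perp=\{\varphi\in\mathbb{S}_\lambda V^*\mid\varphi*u=0\ \forall u\in U\}$. Geometric Schur square. The $G$-action on each $\mathbb{S}_\alpha V^*$ differentiates to an action of $\mathfrak{gl}(V)$ on $\mathbb{S}^\bullet V^*$. For $P=[p]\in\mathbb{P}(\mathbb{S}_\lambda V)$, $$I_{\mathrm S}(P)=\{\varphi\in\mathbb{S}^\bullet V^*\mid\varphi*p=0\},\qquad I_{\mathrm S}(P)^{\langle2\rangle}=\{\varphi\in\mathbb{S}^\bullet V^*\mid\varphi*p=0\text{ and }(\xi\cdot\varphi)*p=0\text{ for every }\xi\in\mathfrak{gl}(V)\}.$$ *)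

(* Defs.v *)
From HB Require Import structures.
From mathcomp Require Import all_boot all_order all_algebra.
From mathcomp Require Import boolp classical_sets functions reals complex.
(* Not imported: its notations clash with those of classical_sets. *)
From mathcomp Require mpoly.

Set Implicit Arguments.
Unset Strict Implicit.
Unset Printing Implicit Defensive.

Import GRing.Theory.
Local Open Scope classical_set_scope.
Local Open Scope ring_scope.

Record intpart := IntPart {
  parts :> seq nat;
  _ : sorted geq parts && (0%N \notin parts) }.
HB.instance Definition _ := [isSub for parts].
HB.instance Definition _ := [Choice of intpart by <:].

(* Parts and columns are indexed from 0: column c has as many boxes as there
   are parts larger than c. *)
Definition conjp (al : seq nat) : seq nat :=
  mkseq (fun c => count (fun a => c < a)%N al) (head 0%N al).

Definition part_sub (mu la : seq nat) : bool :=
  all (fun i => nth 0%N mu i <= nth 0%N la i)%N (iota 0 (size mu)).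

Definition skew_cols (a b : seq nat) : seq nat :=
  mkseq (fun c => nth 0 b c - nth 0 a c)%N (size b).

(* The boxes (column, row) of the diagram whose list of column heights is s. *)
Definition cells (s : seq nat) : seq (nat * nat) :=
  [seq (c, r) | c <- iota 0 (size s), r <- iota 0 (nth 0%N s c)].
Definition box (s : seq nat) : finType := seq_sub (cells s).
Definition column s (b : box s) : nat := (val b).1.

Definition upd (I : finType) (U : Type) (v : {ffun I -> U}) (b : I) (u : U)
  : {ffun I -> U} := [ffun b' => if b' == b then u else v b'].

Section Schur.
Variable F : fieldType.

(* Functions of one vector of U per box. The tensor product over the columns c
   of the exterior powers \bigwedge^{s_c} of U^* is the subspace [ext U s] of the
   functions that are multilinear, and alternating in the boxes of each column;
   u_1 /\ ... /\ u_k stands for the function (v_1, ..., v_k) |-> det (u_i(v_j)).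
   Tensors on V^* thus have type [tens V s], and tensors on V = V^** have type
   [tens (dualv V) s]. *)
Definition tens (U : vectType F) (s : seq nat) : lmodType F :=
  {ffun box s -> U} -> F^o.

Definition multilinear (U : vectType F) (s : seq nat) (x : tens U s) : Prop :=
  forall (v : {ffun box s -> U}) (b : box s) (a : F) (u u' : U),
    x (upd v b (a *: u + u')) = a * x (upd v b u) + x (upd v b u').

Definition ext (U : vectType F) (s : seq nat) : set (tens U s) :=
  [set x | multilinear x /\
     forall (v : {ffun box s -> U}) (b b' : box s),
       b != b' -> column b = column b' -> v b = v b' -> x v = 0].
Arguments ext : clear implicits.

Variable V : vectType F.

Definition dualv : vectType F := 'Hom(V, F^o).

Definition isGL (g : 'End(V)) : Prop := lker g == 0%VS.

Definition gact (s : seq nat) (g : 'End(V)) (x : tens dualv s) : tens dualv s :=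
  fun xi => x [ffun b => (xi b \o g)%VF].

Definition gactd (s : seq nat) (g : 'End(V)) (f : tens V s) : tens V s :=
  fun v => f [ffun b => (g^-1)%VF (v b)].

(* The differential of gactd: see gl_actd_derivative below. *)
Definition gl_actd (s : seq nat) (X : 'End(V)) (f : tens V s) : tens V s :=
  fun v => - \sum_(b : box s) f (upd v b (X (v b))).

Section Modules.
Variables (T : lmodType F) (act : 'End(V) -> T -> T).

Definition is_subspace (W : set T) : Prop :=
  W 0 /\ forall (a : F) (x y : T), W x -> W y -> W (a *: x + y).

Definition submodule (W : set T) : Prop :=
  is_subspace W /\ forall (g : 'End(V)) (x : T), isGL g -> W x -> W (act g x).

Definition irreducible (W : set T) : Prop :=
  [/\ submodule W, W <> [set 0] &
      forall W' : set T, submodule W' -> W' `<=` W -> W' = [set 0] \/ W' = W].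
End Modules.

(* g fixes the flag of the ordered basis e, with diagonal entries t *)
Definition upper_triangular (e : seq V) (t : nat -> F) (g : 'End(V)) : Prop :=
  forall j, (j < size e)%N ->
    t j != 0 /\ g e`_j - t j *: e`_j \in <<take j e>>%VS.

(* x is a highest-weight vector of weight al for the Borel subgroup of the
   upper triangular matrices in the basis e, which acts on x by the character
   t_1^{al_1} ... t_n^{al_n}. *)
Definition highest_weight_vector (al : intpart) (e : seq V)
    (x : tens dualv (conjp al)) : Prop :=
  x <> 0 /\ forall (t : nat -> F) (g : 'End(V)), upper_triangular e t g ->
    gact g x = (\prod_(j < size e) t j ^+ nth 0%N al j) *: x.

Definition has_highest_weight (al : intpart) (W : set (tens dualv (conjp al)))
  : Prop :=
  exists (e : seq V) (x : tens dualv (conjp al)),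
    [/\ basis_of fullv e, W x & @highest_weight_vector al e x].
Arguments has_highest_weight : clear implicits.

(* S_al V: the submodule in the column realization which is irreducible of
   highest weight al. *)
Definition schur (al : intpart) : set (tens dualv (conjp al)) :=
  xget [set 0] [set W | [/\ W `<=` ext dualv (conjp al),
                            irreducible (@gact _) W & has_highest_weight al W]].
Arguments schur : clear implicits.

(* B induces an isomorphism of GL(V)-modules from W onto the dual of S. Every
   linear form on S is the restriction of one on the ambient space. *)
Definition dual_iso (s : seq nat) (W : set (tens V s)) (S : set (tens dualv s))
    (B : tens V s -> {scalar (tens dualv s)}) : Prop :=
  [/\ forall (a : F) f f' x, W f -> W f' -> S x ->
        B (a *: f + f') x = a * B f x + B f' x,
      forall (g : 'End(V)) f x, isGL g -> W f -> S x ->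
        B (gactd g f) x = B f (gact (g^-1)%VF x),
      forall f, W f -> (forall x, S x -> B f x = 0) -> f = 0 &
      forall l : {scalar (tens dualv s)},
        exists2 f, W f & forall x, S x -> B f x = l x].

(* S_al V^*: the submodule isomorphic to the dual of S_al V. *)
Definition schurd (al : intpart) : set (tens V (conjp al)) :=
  xget [set 0] [set W | [/\ W `<=` ext V (conjp al),
                            submodule (@gactd _) W &
                            exists B, dual_iso W (schur al) B]].
Arguments schurd : clear implicits.

(* Families of tensors on V^* indexed by partitions; [Schur_bullet] is the
   direct sum of the S_al V^* with at most n = dim V parts. *)
Definition graded_family := forall al : intpart, tens V (conjp al).

Definition Schur_bullet : set graded_family :=
  [set phi | [/\ forall al : intpart, (size al <= \dim {:V})%N ->
                   schurd al (phi al),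
                 forall al : intpart, (\dim {:V} < size al)%N -> phi al = 0 &
                 exists r : seq intpart,
                   forall al : intpart, al \notin r -> phi al = 0]].

Definition inclusion (al : intpart) (f : tens V (conjp al)) : graded_family :=
  dfwith (fun be : intpart => 0 : tens V (conjp be)) f.

Definition graded_component (A : set graded_family) (al : intpart)
  : set (tens V (conjp al)) :=
  [set f | schurd al f /\ A (inclusion f)].

(* In each column, the boxes of the diagram a come first and are followed by
   those of b outside a, renumbered from 0 in the skew diagram. *)
Definition glue (U : vectType F) (a b : seq nat) (v : {ffun box a -> U})
    (w : {ffun box (skew_cols a b) -> U}) : {ffun box b -> U} :=
  [ffun k : box b =>
    let: (c, r) := val k in
    if (insub (c, r) : option (seq_sub (cells a))) is Some k' then v k'
    else if (insub (c, (r - nth 0 a c)%N)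
             : option (seq_sub (cells (skew_cols a b)))) is Some k'' then w k''
    else 0 : U].

Definition evec (i : 'I_(\dim {:V})) : V := (vbasis {:V})`_i.
Definition covec (i : 'I_(\dim {:V})) : dualv :=
  linfun (coord (vbasis {:V}) i : V -> F^o).

(* Tensor product over the columns of the skew-symmetric contractions. With
   f = f_1 /\ ... /\ f_k, the contraction in one column is
     (f _| x)(xi) = x (f_1, ..., f_k, xi)
                  = 1/k! sum_i f (e_i1, ..., e_ik) x (e^i1, ..., e^ik, xi),
   for any basis e of V with dual basis e^. *)
Definition contraction (a b : seq nat) (f : tens V a) (x : tens dualv b)
  : tens dualv (skew_cols a b) :=
  fun xi => (\prod_(k <- a) k`!%:R)^-1 *
    \sum_(i : {ffun box a -> 'I_(\dim {:V})})
      f [ffun k => evec (i k)] * x (glue [ffun k => covec (i k)] xi).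

Definition apolar (mu la : intpart) (f : tens V (conjp mu))
    (x : tens dualv (conjp la)) : tens dualv (skew_cols (conjp mu) (conjp la)) :=
  if part_sub mu la then contraction f x else 0.

Definition perp (la : intpart) (U : set (tens dualv (conjp la)))
  : set (tens V (conjp la)) :=
  [set f | schurd la f /\ forall u, U u -> apolar f u = 0].

(* Points of P(S_la V) are represented by nonzero vectors: x is in
   [flag_variety V la] when it is nonzero and its class is in the orbit of the
   class of a highest-weight vector. *)
Definition flag_variety (la : intpart) : set (tens dualv (conjp la)) :=
  [set x | exists (e : seq V) (v : tens dualv (conjp la)) (g : 'End(V)) (c : F),
     [/\ basis_of fullv e, schur la v /\ @highest_weight_vector la e v, isGL g,
         c != 0 & x = c *: gact g v]].
Arguments flag_variety : clear implicits.

Definition flag_cone (la : intpart) : set (tens dualv (conjp la)) :=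
  [set x | x = 0 \/ flag_variety la x].
Arguments flag_cone : clear implicits.

(* Zariski tangent space at p, inside the vector space S, to the subset Z of
   S: the common kernel of the differentials at p of the polynomial functions
   that vanish on Z. A polynomial function is a polynomial q in finitely many
   linear forms l_i. *)
Definition zariski_tangent (T : lmodType F) (S Z : set T) (p : T) : set T :=
  [set w | S w /\
     forall (m : nat) (l : 'I_m -> {scalar T}) (q : mpoly.mpoly m F),
       (forall z, Z z -> mpoly.meval (fun i => l i z) q = 0) ->
       \sum_(i < m) mpoly.meval (fun j => l j p) (mpoly.mderiv i q) * l i w = 0].

Definition affine_tangent (la : intpart) (p : tens dualv (conjp la))
  : set (tens dualv (conjp la)) := zariski_tangent (schur la) (flag_cone la) p.

Definition apolar_ideal (la : intpart) (p : tens dualv (conjp la))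
  : set graded_family :=
  [set phi | Schur_bullet phi /\ forall mu : intpart, apolar (phi mu) p = 0].

Definition geom_square (la : intpart) (p : tens dualv (conjp la))
  : set graded_family :=
  [set phi | @apolar_ideal la p phi /\
     forall (X : 'End(V)) (mu : intpart), apolar (gl_actd X (phi mu)) p = 0].

End Schur.

Arguments ext {F} U s _.
Arguments schur {F} V al _.
Arguments schurd {F} V al _.
Arguments graded_component {F V} A al _.
Arguments perp {F V} la U _.
Arguments flag_variety {F} V la _.
Arguments flag_cone {F} V la _.
Arguments affine_tangent {F V} la p _.
Arguments apolar_ideal {F V} la p _.
Arguments geom_square {F V} la p _.

Section Derivative.
Variables (F : fieldType) (V : vectType F).

Lemma multilinear_curve (s : seq nat) (f : tens V s) (w : {ffun box s -> V}) :
  multilinear f -> forall (r : seq (box s)) (v : {ffun box s -> V}), uniq r ->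
  exists q : {poly F},
    [/\ forall t, f [ffun b => if b \in r then v b + t *: w b else v b] = q.[t],
        q.[0] = f v &
        q^`().[0] = \sum_(b <- r) f (upd v b (w b))].
Proof.
move=> fl; elim=> [|b r IHr] v /=.
  move=> _; exists (f v)%:P; split=> [t||]; rewrite ?hornerC //.
    by congr (f _); apply/ffunP=> b; rewrite ffunE.
  by rewrite derivC horner0 big_nil.
case/andP=> brN ur.
have [q [q1 q2 q3]] := IHr v ur.
have [q' [q1' q2' q3']] := IHr (upd v b (w b)) ur.
exists (q + 'X * q'); split=> [t||].
- set h := [ffun b0 => if b0 \in r then v b0 + t *: w b0 else v b0].
  have -> : [ffun b0 => if b0 \in b :: r then v b0 + t *: w b0 else v b0]
          = upd h b (t *: w b + v b).
    apply/ffunP=> k; rewrite !ffunE in_cons.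
    by case: eqP => [->|//] /=; rewrite addrC.
  rewrite fl !hornerE -q1 -q1' addrC; congr (_ + _ * _).
    congr (f _); apply/ffunP=> k; rewrite !ffunE.
    by case: eqP => // ->; rewrite (negPf brN).
  congr (f _); apply/ffunP=> k; rewrite !ffunE.
  by case: eqP => // ->; rewrite (negPf brN).
- by rewrite !hornerE.
- by rewrite derivD derivM derivX mul1r !hornerD hornerM hornerX mul0r addr0
             q3 q2' big_cons addrC.
Qed.

(* The elements (1 - tX)^-1 of GL(V) form a curve through 1 with velocity X at
   t = 0, along which gactd is polynomial in t, with derivative gl_actd X. *)
Lemma gl_actd_derivative (s : seq nat) (X : 'End(V)) (f : tens V s)
    (v : {ffun box s -> V}) :
  multilinear f ->
  exists q : {poly F},
    (forall t, isGL (\1 - t *: X)%VF ->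
       gactd ((\1 - t *: X)^-1)%VF f v = q.[t]) /\
    q^`().[0] = gl_actd X f v.
Proof.
move=> fl; have [q [q1 _ q3]] := multilinear_curve [ffun b => - X (v b)] fl v (enum_uniq (box s)).
exists q; split=> [t gt|].
  rewrite -q1; congr (f _); apply/ffunP=> b; rewrite !ffunE mem_enum /=.
  have gV : lker (\1 - t *: X)^-1%VF == 0%VS.
    by apply/lker0P; apply: can_inj (lker0_lfunVK gt).
  have -> : (((\1 - t *: X)^-1)^-1)%VF = (\1 - t *: X)%VF.
    by rewrite -[RHS](lker0_compKf gV) lker0_compVf // comp_lfun1r.
  by rewrite !lfunE /= !lfunE /= lfunE /= scalerN.
rewrite q3 /gl_actd -sumrN -[RHS]big_enum /=; apply: eq_bigr => b _; rewrite ffunE.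
have f0 : f (upd v b 0) = 0.
  by have := fl v b (-1) 0 0; rewrite scaler0 add0r mulN1r addNr.
by have := fl v b (-1) (X (v b)) 0; rewrite scaleN1r addr0 f0 addr0 mulN1r.
Qed.
End Derivative.

(* Main.v *)
From HB Require Import structures.
Require Import Defs.
From mathcomp Require Import all_boot all_order all_algebra perm zify ring.
From mathcomp Require Import boolp classical_sets functions reals complex.
From mathcomp Require mpoly.
(* Only the canonical structures: the notations clash with those of
   classical_sets. *)
Import (canonicals) mpoly.

(* A highest-weight vector v for the basis e is killed by any covector of column
   c that vanishes on e_0, ..., e_{h-1}, where h is the height of the column:
   acting with the torus elements that double e_0, ..., e_{k-1} shows that a
   coordinate v(e^I) can be nonzero only if I takes values below k in as many
   boxes as there are in the first k rows, and the entries of a column are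
   distinct. Tensors with this property, hence all points z of the cone, satisfy
   the exchange relations of Pluecker,
     sum_{b in column c} z(xi with eta_b' in b) z(eta with xi_b in b') = z(xi) z(eta)
   for b' in a column not longer than c (this is Cramer's rule).

   Linearizing these relations at p and evaluating them at eta = (e^0, e^1, ...)
   in each column shows that a tangent vector w is determined by its coordinates
   w(std) and w(std with e^j in b) for j at least the height of the column of b,
   and that the latter depend only on j and on the row of b. So they are those of
   X.p for some X in gl(V), and the tangent space is spanned by p and gl(V).p.
   Conversely p and X.p are tangent, since polynomials that vanish on the cone
   vanish along t |-> (1 + tX).p.

   The theorem follows because (X.f) * p = - f * (X.p) when f and p have the same
   shape. *)

Set Implicit Arguments.
Unset Strict Implicit.
Unset Printing Implicit Defensive.

Import Order.TTheory GRing.Theory Num.Theory.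
Local Open Scope classical_set_scope.
Local Open Scope ring_scope.

(** * Boxes of a diagram and replacement of one argument *)

Section Boxes.
Variable s : seq nat.

Definition row_of (b : box s) : nat := (val b).2.
Definition height (b : box s) : nat := nth 0%N s (column b).

Lemma row_lt (b : box s) : (row_of b < height b)%N.
Proof.
rewrite /height /row_of /column; case: b => -[c r] /= /allpairsPdep[c' [r' []]].
by rewrite !mem_iota !add0n /= => _ r'lt [-> ->].
Qed.

Lemma column_lt (b : box s) : (column b < size s)%N.
Proof.
rewrite /column; case: b => -[c r] /= /allpairsPdep[c' [r' []]].
by rewrite !mem_iota !add0n /= => c'lt _ [-> _].
Qed.

Lemma box_exists (c r : nat) : (r < nth 0%N s c)%N ->
  exists b : box s, column b = c /\ row_of b = r.
Proof.
move=> rlt; have clt : (c < size s)%N.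
  by rewrite ltnNge; apply/negP => cs; rewrite nth_default in rlt.
have cr : (c, r) \in cells s.
  by apply/allpairsPdep; exists c, r; rewrite !mem_iota.
by exists (SeqSub cr).
Qed.

Lemma box_inj (b b' : box s) : column b = column b' -> row_of b = row_of b' -> b = b'.
Proof.
rewrite /column /row_of => cE rE; apply: val_inj.
by rewrite [val b]surjective_pairing cE rE -surjective_pairing.
Qed.

Lemma sum_box (R : nmodType) (f : nat * nat -> R) :
  \sum_(b : box s) f (val b) =
  \sum_(0 <= c < size s) \sum_(0 <= r < nth 0%N s c) f (c, r).
Proof.
have cells_uniq : uniq (cells s).
  apply: allpairs_uniq_dep => [||[c r] [c' r'] _ _ [-> ->]] //; first exact: iota_uniq.
  by move=> c _; apply: iota_uniq.
transitivity (\sum_(x <- cells s) f x).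
  rewrite -(big_map (val : box s -> nat * nat) xpredT f).
  apply: perm_big; apply: uniq_perm => //.
    by rewrite map_inj_uniq ?index_enum_uniq //; apply: val_inj.
  move=> x; apply/mapP/idP => [[y _ ->]|xs]; first exact: (valP y).
  by exists (SeqSub xs); rewrite ?mem_index_enum.
by rewrite big_allpairs_dep /index_iota !subn0; apply: eq_bigr => c _; rewrite subn0.
Qed.

End Boxes.

(* [upd], sealed: unification unfolds [upd] whenever it fails to match it. *)
HB.lock Definition repl (I : finType) (U : Type) (v : {ffun I -> U}) b u := upd v b u.

Section Upd.
Variables (I : finType) (U : Type).
Implicit Types (v : {ffun I -> U}) (b : I).

Lemma replE v b u : repl v b u = upd v b u.
Proof. by rewrite repl.unlock. Qed.
Lemma repl_same v b u : repl v b u b = u. Proof. by rewrite replE ffunE eqxx. Qed.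
Lemma repl_other v b u b' : b' != b -> repl v b u b' = v b'.
Proof. by rewrite replE ffunE => /negPf->. Qed.
Lemma repl_id v b : repl v b (v b) = v.
Proof. by apply/ffunP => k; rewrite replE ffunE; case: eqP => [->|]. Qed.
Lemma repl_repl v b u u' : repl (repl v b u) b u' = repl v b u'.
Proof. by apply/ffunP => k; rewrite !replE !ffunE; case: eqP. Qed.
Lemma replC v b b' u u' : b != b' ->
  repl (repl v b u) b' u' = repl (repl v b' u') b u.
Proof.
move=> bb'; apply/ffunP => k; rewrite !replE !ffunE; case: (eqVneq k b') => // ->.
by rewrite eq_sym (negPf bb').
Qed.
End Upd.

(** * Multilinear and alternating functions on boxes *)

Section Multilinear.
Variables (F : fieldType) (U : vectType F) (s : seq nat).
Implicit Types (x : tens U s) (v : {ffun box s -> U}) (b : box s).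

Lemma multilinearP x : multilinear x <-> forall v b a u u',
  x (repl v b (a *: u + u')) = a * x (repl v b u) + x (repl v b u').
Proof.
by split=> xl v b a u u'; [rewrite !replE xl | have := xl v b a u u'; rewrite !replE].
Qed.

Lemma multilinear0 x : multilinear x -> forall v b, x (repl v b 0) = 0.
Proof.
move=> xl v b; apply: (addrI (x (repl v b 0))).
by rewrite addr0 -[X in X + _]mul1r -((multilinearP x).1 xl) scale1r addr0.
Qed.

Lemma multilinearZ x : multilinear x -> forall v b a u,
  x (repl v b (a *: u)) = a * x (repl v b u).
Proof.
by move=> xl v b a u; rewrite -[a *: u]addr0 ((multilinearP x).1 xl) (multilinear0 xl) addr0.
Qed.

Lemma multilinearD x : multilinear x -> forall v b u u',
  x (repl v b (u + u')) = x (repl v b u) + x (repl v b u').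
Proof. by move=> xl v b u u'; rewrite -[u]scale1r ((multilinearP x).1 xl) mul1r scale1r. Qed.

Lemma multilinear_sum x : multilinear x -> forall v b (J : Type) (r : seq J)
    (P : pred J) (a : J -> F) (u : J -> U),
  x (repl v b (\sum_(j <- r | P j) a j *: u j)) =
  \sum_(j <- r | P j) a j * x (repl v b (u j)).
Proof.
move=> xl v b J r P a u.
elim/big_rec2: _ => [|j y z _ <-]; first exact: multilinear0.
exact: ((multilinearP x).1 xl).
Qed.

(** Polarization: put [v b + v b'] in both boxes and expand; the terms with a repeated argument
    vanish. *)
Lemma ext_swap x : ext U s x -> forall v b b', b != b' -> column b = column b' ->
  x (repl (repl v b (v b')) b' (v b)) = - x v.
Proof.
move=> [xl xa] v b b' bb' cbb'; apply/eqP; rewrite -addr_eq0; apply/eqP.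
have b'b : b' != b by rewrite eq_sym.
have alt u : x (repl (repl v b u) b' u) = 0.
  by apply: (xa _ b b') => //; rewrite repl_same repl_other // repl_same.
have add u : x (repl (repl v b (v b + v b')) b' u) =
    x (repl (repl v b (v b)) b' u) + x (repl (repl v b (v b')) b' u).
  by rewrite (replC _ _ _ bb') (multilinearD xl) !(replC v u _ b'b).
have := alt (v b + v b').
by rewrite (multilinearD xl) !add !alt add0r addr0 !repl_id.
Qed.

Lemma multilinear_eq0 (n : nat) (eps : 'I_n -> U) (k : 'I_n -> U -> F) x :
  (forall u, u = \sum_i k i u *: eps i) -> multilinear x ->
  (forall I : {ffun box s -> 'I_n}, x [ffun b => eps (I b)] = 0) ->
  forall v, x v = 0.
Proof.
move=> eps_span xl x0.
(* The boxes outside [r] already hold basis vectors; the induction expands one further box at a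
   time. *)
suff H (r : seq (box s)) v :
    (forall b, b \notin r -> exists i, v b = eps i) -> x v = 0.
  by move=> v; apply: (H (enum (box s))) => b; rewrite mem_enum.
elim: r v => [|b r IHr] v vr.
  have /fin_all_exists[I vI] : forall b, exists i, v b = eps i by move=> b; apply: vr.
  by rewrite -[RHS](x0 (finfun I)); congr (x _); apply/ffunP => b; rewrite !ffunE.
rewrite -(repl_id v b) (eps_span (v b)) (multilinear_sum xl) big1 // => i _.
rewrite IHr ?mulr0 // => b' b'r; case: (eqVneq b' b) => [->|nb]; first by exists i; rewrite repl_same.
by rewrite repl_other //; apply: vr; rewrite inE negb_or nb.
Qed.

End Multilinear.

Lemma functional_sum (F : fieldType) (U : lmodType F) (f : U -> F) :
  (forall a u u', f (a *: u + u') = a * f u + f u') ->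
  forall (J : Type) (r : seq J) (P : pred J) (a : J -> F) (u : J -> U),
  f (\sum_(j <- r | P j) a j *: u j) = \sum_(j <- r | P j) a j * f (u j).
Proof.
move=> fD J r P a u; elim/big_rec2: _ => [|j y z _ <-]; last exact: fD.
by apply: (addrI (f 0)); rewrite -[X in X + _]mul1r -fD scale1r !addr0.
Qed.

(** * Tensors adapted to a flag and their Pluecker relations *)

Section Flag.
Variables (F : fieldType) (U : vectType F) (s : seq nat) (n : nat).
Variables (eps : 'I_n -> U) (k : 'I_n -> U -> F).
Hypothesis eps_span : forall u, u = \sum_i k i u *: eps i.
Hypothesis k_eps : forall i j, k i (eps j) = (i == j)%:R.
Hypothesis height_le : forall b : box s, (height b <= n)%N.
Implicit Types (x z w : tens U s) (v xi eta : {ffun box s -> U}) (b : box s).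

(** In the application [U] is V^* and [k i] is evaluation at e_i, so the condition on [v b] says
    that this covector annihilates the member of dimension [height b] of the flag. *)
Definition flag_adapted x : Prop :=
  forall v b, (forall i : 'I_n, (i < height b)%N -> k i (v b) = 0) -> x v = 0.

(** The row of [b] as a basis index. Thus [stdv] is the filling of the diagram with eps_r all along
    row r, the one of highest weight. *)
Definition std b : 'I_n := Ordinal (leq_trans (row_lt b) (height_le b)).
Definition stdv : {ffun box s -> U} := [ffun b => eps (std b)].

Lemma stdvE b : stdv b = eps (std b). Proof. by rewrite ffunE. Qed.

Lemma height_col b b' : column b = column b' -> height b = height b'.
Proof. by rewrite /height => ->. Qed.

Lemma std_exists b (i : 'I_n) : (i < height b)%N ->
  exists2 b', column b' = column b & std b' = i.
Proof.
by move=> /box_exists[b' [cb rb]]; exists b' => //; apply: val_inj.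
Qed.

Definition boxes_in_col (c : nat) : {set box s} := [set b | column b == c].

Lemma std_inj b b' : column b = column b' -> std b = std b' -> b = b'.
Proof. by move=> cE /(congr1 val) rE; apply: box_inj. Qed.

Lemma std_image b :
  [set std b' | b' in boxes_in_col (column b)]%SET = [set i : 'I_n | (i < height b)%N]%SET.
Proof.
apply/setP => i; rewrite inE; apply/imsetP/idP => [[b' + ->]|/std_exists[b' cb <-]].
  by rewrite inE => /eqP/height_col <-; apply: row_lt.
by exists b'; rewrite // inE cb.
Qed.

Lemma card_boxes_in_col b :
  #|boxes_in_col (column b)| = #|[set i : 'I_n | (i < height b)%N]%SET|.
Proof.
rewrite -std_image card_in_imset // => b1 b2; rewrite !inE => /eqP c1 /eqP c2.
by apply: std_inj; rewrite c1 c2.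
Qed.

Lemma column_image (I : {ffun box s -> 'I_n}) b :
  {in boxes_in_col (column b) &, injective I} ->
  (forall b', column b' = column b -> (I b' < height b)%N) ->
  [set I b' | b' in boxes_in_col (column b)]%SET = [set i : 'I_n | (i < height b)%N]%SET.
Proof.
move=> Iinj Ilt; apply/eqP; rewrite eqEcard card_in_imset // card_boxes_in_col leqnn andbT.
by apply/fintype.subsetP => _ /imsetP[b' + ->]; rewrite !inE => /eqP/Ilt.
Qed.

Lemma column_surj (I : {ffun box s -> 'I_n}) b (i : 'I_n) :
  {in boxes_in_col (column b) &, injective I} ->
  (forall b', column b' = column b -> (I b' < height b)%N) ->
  (i < height b)%N -> exists2 b', column b' = column b & I b' = i.
Proof.
move=> Iinj Ilt ilt.
have : i \in [set I b' | b' in boxes_in_col (column b)]%SET by rewrite column_image // inE.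
by case/imsetP => b'; rewrite inE => /eqP cb ->; exists b'.
Qed.

(** Pigeonhole: a column has as many boxes as there are indices below its height, and [b] spends one
    box on a larger index. *)
Lemma column_missing (I : {ffun box s -> 'I_n}) b :
  (height b <= I b)%N ->
  exists2 i : 'I_n, (i < height b)%N & forall b', column b' = column b -> I b' != i.
Proof.
move=> Ib; pose B := [set i : 'I_n | (i < height b)%N]%SET.
have : ~~ (B \subset [set I b' | b' in boxes_in_col (column b)]%SET).
  apply/negP => BA; have : B == [set I b' | b' in boxes_in_col (column b)]%SET.
    by rewrite eqEcard BA -card_boxes_in_col leq_imset_card.
  move/eqP/setP/(_ (I b)); rewrite inE ltnNge Ib /=.
  by move=> /esym/imsetP; apply; exists b; rewrite // inE.
case/fintype.subsetPn => i; rewrite inE => ilt iA; exists i => // b' cb.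
by apply: contraNneq iA => <-; apply/imsetP; exists b'; rewrite // inE cb.
Qed.

(** Induction on the number of boxes whose entry differs from that of [stdv]. If no entry repeats in
    the column of [b], that column is a permutation of the standard one, and a transposition brings
    one more box into place at the cost of a sign. *)
Lemma ext_sorted_eq0 x : ext U s x -> x stdv = 0 ->
  forall I : {ffun box s -> 'I_n}, (forall b, (I b < height b)%N) ->
  x [ffun b => eps (I b)] = 0.
Proof.
move=> xE xstd I; have [m] := ubnP #|[pred b | I b != std b]|.
elim: m I => // m IHm I; rewrite ltnS => Im Ilt.
have [/existsP[b Ib]|] := boolP [exists b, I b != std b]; last first.
  rewrite negb_exists => /forallP Istd; rewrite -[RHS]xstd; congr (x _).
  by apply/ffunP => b; rewrite !ffunE; have /negPn/eqP-> := Istd b.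
have [xl xa] := xE.
have [/dinjectiveP Iinj|/dinjectivePn[b1 + [b2]]] :=
    boolP (dinjectiveb I (boxes_in_col (column b))); last first.
  rewrite !inE => /eqP c1 /andP[b21 /eqP c2] I12.
  by apply: (xa _ b1 b2); rewrite ?ffunE ?I12 ?c1 ?c2 // eq_sym.
have [|b' cb Ib'] := column_surj Iinj _ (row_lt b : std b < _)%N.
  by move=> b' cb; rewrite -(height_col cb) Ilt.
have bb' : b != b' by apply: contraNneq Ib => bb'; rewrite {1}bb' Ib'.
apply: oppr_inj; rewrite oppr0 -(ext_swap xE _ bb' (esym cb)).
have -> : repl (repl [ffun b => eps (I b)] b ([ffun b => eps (I b)] b')) b'
    ([ffun b => eps (I b)] b) =
    [ffun b0 => eps ([ffun b1 => I (tperm b b' b1)] b0)].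
  apply/ffunP => b0; rewrite !ffunE; case: tpermP => [->|->|/eqP nb /eqP nb'].
  - by rewrite repl_other ?repl_same.
  - by rewrite repl_same.
  - by rewrite !repl_other // ffunE.
apply: IHm => [|b0]; last first.
  by rewrite ffunE; case: tpermP => // ->; [rewrite -(height_col cb)|rewrite (height_col cb)].
(* After the swap [b] is in place, and [b'] was out of place before, since it held the entry of
   [b]. *)
apply: leq_trans Im; apply/proper_card/properP; split; last first.
  by exists b; rewrite ?inE // ffunE tpermL Ib' eqxx.
apply/fintype.subsetP => b0; rewrite !inE ffunE; case: tpermP => // ->; rewrite ?Ib' ?eqxx // => _.
by apply: contraNneq bb' => /(std_inj (esym cb)) ->.
Qed.

Lemma ext_eq0 x : ext U s x -> x stdv = 0 ->
  (forall (I : {ffun box s -> 'I_n}) b, (height b <= I b)%N -> x [ffun b => eps (I b)] = 0) ->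
  forall v, x v = 0.
Proof.
move=> xE xstd xbig; apply: (multilinear_eq0 eps_span xE.1) => I.
have [/forallP Ilt|] := boolP [forall b, (I b < height b)%N]; first exact: ext_sorted_eq0.
by rewrite negb_forall => /existsP[b]; rewrite -leqNgt; apply: xbig.
Qed.

Lemma adapted_eps x (I : {ffun box s -> 'I_n}) b :
  flag_adapted x -> (height b <= I b)%N -> x [ffun b => eps (I b)] = 0.
Proof.
move=> xA Ib; apply: (xA _ b) => i ib; rewrite ffunE k_eps.
by case: eqP => // iI; rewrite iI ltnNge Ib in ib.
Qed.

Lemma adapted_eps_at x v b' (i : 'I_n) :
  flag_adapted x -> (height b' <= i)%N -> v b' = eps i -> x v = 0.
Proof.
move=> xA ib vb; apply: (xA _ b') => j jb; rewrite vb k_eps.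
by case: eqP => // iI; rewrite iI ltnNge ib in jb.
Qed.

(** In the expansion of [u], an index not below the height is killed by adaptedness, and an index
    below it other than [I b] already occurs elsewhere in the column. *)
Lemma repl_eps x (I : {ffun box s -> 'I_n}) b u : ext U s x -> flag_adapted x ->
  {in boxes_in_col (column b) &, injective I} ->
  (forall b', column b' = column b -> (I b' < height b)%N) ->
  x (repl [ffun b => eps (I b)] b u) = k (I b) u * x [ffun b => eps (I b)].
Proof.
move=> [xl xa] xA Iinj Ilt; rewrite {1}[u]eps_span (multilinear_sum xl) (bigD1 (I b)) //=.
rewrite big1 ?addr0.
  by congr (_ * x _); rewrite -[RHS](repl_id _ b); congr (repl _ _ _); rewrite ffunE.
move=> i ib; have [ilt|ige] := ltnP i (height b); last first.
  by rewrite (adapted_eps_at xA ige) ?repl_same // mulr0.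
have [b' cb sb'] := column_surj Iinj Ilt ilt.
have b'b : b' != b by apply: contraNneq ib => <-; rewrite sb'.
by rewrite (xa _ b b') ?mulr0 // 1?eq_sym // repl_same repl_other // ffunE sb'.
Qed.

Lemma repl_std x b u : ext U s x -> flag_adapted x ->
  x (repl stdv b u) = k (std b) u * x stdv.
Proof.
move=> xE xA; have stdE : stdv = [ffun b => eps ([ffun b => std b] b)].
  by apply/ffunP => b'; rewrite !ffunE.
rewrite stdE repl_eps ?ffunE // => [b1 b2|b' cb].
  by rewrite !inE !ffunE => /eqP c1 /eqP c2; apply: std_inj; rewrite c1 c2.
by rewrite ffunE -(height_col cb) row_lt.
Qed.

(** Cramer's rule: in column [c], of height h, [z] is a multiple of the determinant of the first h
    coordinates, and [psi] depends on these coordinates only. Both sides are multilinear in [xi], so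
    basis vectors suffice. *)
Lemma plucker z : ext U s z -> flag_adapted z ->
  forall (c : nat) (psi : U -> F),
  (forall a u u', psi (a *: u + u') = a * psi u + psi u') ->
  (forall u, (forall i : 'I_n, (i < nth 0%N s c)%N -> k i u = 0) -> psi u = 0) ->
  forall xi u,
  \sum_(b | column b == c) z (repl xi b u) * psi (xi b) = z xi * psi u.
Proof.
move=> zE zA c psi psiD psi0 xi u; have [zl za] := zE.
pose y : tens U s := fun xi =>
  \sum_(b | column b == c) z (repl xi b u) * psi (xi b) - z xi * psi u.
suff : y xi = 0 by move/eqP; rewrite subr_eq0 => /eqP.
move: xi; apply: (multilinear_eq0 eps_span).
  apply/multilinearP => v b0 a u1 u2; rewrite /y.
  pose T t b := z (repl (repl v b0 t) b u) * psi (repl v b0 t b).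
  have TD b : T (a *: u1 + u2) b = a * T u1 b + T u2 b.
    rewrite /T; have [->|bb0] := eqVneq b b0.
      by rewrite !repl_repl !repl_same psiD mulrDr mulrCA.
    rewrite !(repl_other _ _ bb0) !(replC v _ u (_ : b0 != b)) 1?eq_sym //.
    by rewrite ((multilinearP z).1 zl) mulrDl mulrA.
  rewrite (eq_bigr _ (fun b _ => TD b)) big_split -mulr_sumr /=.
  rewrite ((multilinearP z).1 zl) mulrDl opprD mulrBr -!mulrA.
  by rewrite !addrA; congr (_ - _); rewrite -!addrA; congr (_ + _); rewrite addrC.
move=> I; pose v : {ffun box s -> U} := [ffun b => eps (I b)].
rewrite -[finfun _]/v /y {y}.
have vE b : v b = eps (I b) by rewrite ffunE.
have psi_eps (j : 'I_n) : (nth 0%N s c <= j)%N -> psi (eps j) = 0.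
  move=> jc; apply: psi0 => i ic; rewrite k_eps.
  by case: eqP => // ij; rewrite ij ltnNge jc in ic.
have [/dinjectiveP Iinj|/dinjectivePn[b1 + [b2]]] :=
    boolP (dinjectiveb I (boxes_in_col c)); last first.
  (* A repeated entry: the right side is zero, and on the left the terms of [b1] and [b2] cancel
     while all others keep the repetition. *)
  rewrite !inE => /eqP c1 /andP[b21 /eqP c2] I12.
  have c12 : column b1 = column b2 by rewrite c1 c2.
  have v12 : v b1 = v b2 by rewrite !vE I12.
  rewrite (za v b1 b2) // 1?eq_sym // mul0r subr0.
  rewrite (bigD1 b1) ?c1 //= (bigD1 b2) ?c2 ?eqxx //= big1 ?addr0 => [|b /andP[/andP[_ bb1] bb2]].
    suff -> : z (repl v b2 u) = - z (repl v b1 u) by rewrite !vE I12 mulNr subrr.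
    rewrite -(ext_swap zE (repl v b1 u) b21 (esym c12)) repl_same repl_other //.
    rewrite (replC _ _ _ b21) repl_repl; congr (z (repl _ _ _)); apply/ffunP => b.
    by have [->|bb1] := eqVneq b b1; rewrite ?repl_same ?repl_other.
  rewrite (za _ b1 b2) ?mul0r // 1?eq_sym // !repl_other // eq_sym //.
have [/existsP[b0 /andP[/eqP cb0 Ib0]]|] :=
    boolP [exists b, (column b == c) && (height b <= I b)%N].
  (* An entry not below the height: [z] vanishes in each term that keeps it, and [psi] kills it in
     the term that replaces it. *)
  rewrite (adapted_eps zA Ib0) mul0r subr0 big1 // => b /eqP cb.
  have [->|bb0] := eqVneq b b0; first by rewrite vE psi_eps ?mulr0 -?cb0.
  by rewrite (adapted_eps_at zA Ib0) ?mul0r // repl_other // eq_sym.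
rewrite negb_exists => /forallP Ilt.
(* If the column is empty, so is the sum, and [psi0] applies to every [u]. *)
have [b0 /eqP cb0|nob] := pickP [pred b : box s | column b == c]; last first.
  rewrite big_pred0 // sub0r psi0 ?mulr0 ?oppr0 // => i /box_exists[b [cb _]].
  by have := nob b; rewrite /= cb eqxx.
have Ilt' b : column b = column b0 -> (I b < height b0)%N.
  by move=> cb; have := Ilt b; rewrite cb cb0 eqxx /= -ltnNge (height_col cb).
have cE := esym cb0; rewrite {c}cE in psi0 Iinj psi_eps Ilt cb0 *.
have zI b : column b == column b0 -> z (repl v b u) * psi (v b) =
    z v * (k (I b) u * psi (eps (I b))).
  by move=> /eqP cb; rewrite repl_eps ?cb ?(height_col cb) // vE mulrCA mulrA.
rewrite (eq_bigr _ zI) -mulr_sumr -mulrBr.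
(* The entries of the column are now exactly the indices below its height, each once, so the sum
   over boxes is the expansion of [psi u]. *)
suff -> : psi u = \sum_(b | column b == column b0) k (I b) u * psi (eps (I b)).
  by rewrite subrr mulr0.
rewrite {1}[u]eps_span (functional_sum psiD) (bigID (fun i : 'I_n => (i < height b0)%N)) /=.
rewrite addrC big1 ?add0r => [|i]; last by rewrite -leqNgt => /psi_eps ->; rewrite mulr0.
transitivity (\sum_(i in [set I b | b in boxes_in_col (column b0)]%SET) k i u * psi (eps i)).
  by apply: eq_bigl => i; rewrite column_image // inE.
by rewrite big_imset //=; apply: eq_bigl => b; rewrite inE.
Qed.

(** The Leibniz rule: for multilinear [x] and [Y] precomposition with an endomorphism X, this is
    X.x, the derivative at t = 0 of (1 + tX).x. *)
Definition deract (Y : U -> U) x : tens U s :=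
  fun xi => \sum_b x (repl xi b (Y (xi b))).

(** The differential at [z], in the direction [w], of the relation in [plucker_exchange]. *)
Definition plucker_tangent z w : Prop :=
  forall xi eta b' c, (height b' <= nth 0%N s c)%N ->
  \sum_(b | column b == c) (w (repl xi b (eta b')) * z (repl eta b' (xi b)) +
                            z (repl xi b (eta b')) * w (repl eta b' (xi b))) =
  w xi * z eta + z xi * w eta.

(** In [plucker], let [psi] be [z] as a function of box [b'] of [eta]. It sees only the first
    [height b'] coordinates, which column [c] covers, being at least as long. *)
Lemma plucker_exchange z : ext U s z -> flag_adapted z ->
  forall xi eta b' c, (height b' <= nth 0%N s c)%N ->
  \sum_(b | column b == c) z (repl xi b (eta b')) * z (repl eta b' (xi b)) =
  z xi * z eta.
Proof.
move=> zE zA xi eta b' c hb'.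
rewrite (plucker zE zA (psi := fun u => z (repl eta b' u))) ?repl_id //.
  exact: (multilinearP z).1 zE.1 eta b'.
move=> u ku; apply: (zA _ b') => i ib'; rewrite repl_same ku //.
exact: leq_trans ib' hb'.
Qed.

Lemma adapted_std_neq0 z : ext U s z -> flag_adapted z -> z <> 0 -> z stdv != 0.
Proof.
move=> zE zA z0; apply/eqP => zstd; apply: z0; apply/funext.
by apply: ext_eq0 => // I b; apply: adapted_eps.
Qed.

(** Every term that leaves [eps j] in box [b] vanishes, since [j] is not below the height of its
    column. *)
Lemma deract_std z Y b (j : 'I_n) : ext U s z -> flag_adapted z -> (height b <= j)%N ->
  deract Y z (repl stdv b (eps j)) = k (std b) (Y (eps j)) * z stdv.
Proof.
move=> zE zA bj; rewrite /deract (bigD1 b) //= repl_same repl_repl repl_std //.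
rewrite big1 ?addr0 // => b1 b1b.
by rewrite (adapted_eps_at zA bj) // repl_other 1?eq_sym // repl_same.
Qed.

(** Take [xi] to be [stdv] with [eps j] in [b], and exchange its column of [b] with box [b'] of
    [stdv]. As [z] vanishes when [eps j] stays in [b], or when box [b'] of [stdv] receives [eps j]
    or another standard entry, only the two coordinates compared survive. *)
Lemma tangent_coord_shift z w : ext U s z -> flag_adapted z -> plucker_tangent z w ->
  forall b b' (j : 'I_n), (height b' <= height b <= j)%N -> std b = std b' ->
  z stdv * w (repl stdv b' (eps j)) = z stdv * w (repl stdv b (eps j)).
Proof.
move=> zE zA wT b b' j /andP[b'b bj] stdbb'.
have xi0 v : z (repl v b (eps j)) = 0.
  by rewrite (adapted_eps_at zA bj) // repl_same.
have := wT (repl stdv b (eps j)) stdv b' (column b) b'b.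
rewrite xi0 mul0r addr0 [RHS]mulrC => <-; rewrite (bigD1 b) //= big1 ?addr0.
  rewrite repl_same !repl_repl (repl_std b' _ zE zA) k_eps.
  have -> : (std b' == j) = false.
    by apply/negbTE; rewrite neq_ltn (leq_trans (row_lt b') (leq_trans b'b bj)).
  rewrite mul0r mulr0 add0r; congr (z _ * _).
  by rewrite -{1}(repl_id stdv b); congr (repl _ _ _); rewrite !stdvE stdbb'.
move=> b1 /andP[/eqP cb1 b1b].
rewrite (repl_other _ _ b1b) (stdvE b1) (repl_std b' _ zE zA) k_eps.
have -> : (std b' == std b1) = false.
  by apply/negbTE; apply: contraNneq b1b => e; apply/eqP/std_inj => //; rewrite stdbb' e.
rewrite (replC _ _ _ (_ : b != b1)) 1?eq_sym // xi0.
by rewrite !mul0r mulr0 addr0.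
Qed.

Lemma tangent_coords z w : ext U s z -> flag_adapted z -> plucker_tangent z w ->
  z stdv != 0 ->
  exists A : 'I_n -> 'I_n -> F, forall b (j : 'I_n), (height b <= j)%N ->
    w (repl stdv b (eps j)) = A (std b) j * z stdv.
Proof.
move=> zE zA wT z0.
(* All boxes of row [r] in columns of height at most [j] give the same quotient, by
   [tangent_coord_shift]. Where there is no such box the entry is unconstrained, and 0 is taken. *)
exists (fun r (j : 'I_n) => if [pick b | (std b == r) && (height b <= j)%N] is Some b
                   then w (repl stdv b (eps j)) / z stdv else 0) => b j bj.
case: pickP => [b' /andP[/eqP sb' b'j]|/(_ b)]; last by rewrite eqxx bj.
rewrite divfK //; apply: (mulfI z0).
have [h|/ltnW h] := leqP (height b) (height b').
  by apply: (tangent_coord_shift zE zA wT) => //; rewrite h.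
by apply/esym/(tangent_coord_shift zE zA wT) => //; rewrite h.
Qed.

(** If a column of a filling has an entry not below its height, it misses some i below the height.
    Exchange this column with the box of [stdv] that holds i: there [z] never receives i, and [w] is
    taken either at a coordinate assumed to be zero or at a filling with a repeated entry. So the
    coordinate of [w] at the filling is zero. *)
Lemma plucker_tangent_eq0 z w : ext U s z -> flag_adapted z -> z stdv != 0 ->
  ext U s w -> plucker_tangent z w -> w stdv = 0 ->
  (forall b (j : 'I_n), (height b <= j)%N -> w (repl stdv b (eps j)) = 0) -> w = 0.
Proof.
move=> zE zA z0 wE wT wstd wcoord; apply/funext; apply: ext_eq0 => // I b0 Ib0.
have [i ib0 Ii] := column_missing Ib0; have [b' cb' sb'] := std_exists ib0.
apply: (mulIf z0); rewrite mul0r.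
have := wT [ffun b => eps (I b)] stdv b' (column b0).
rewrite wstd mulr0 addr0 (height_col cb') => <- //.
rewrite big1 // => b /eqP cb; rewrite [X in repl stdv b' X]ffunE (repl_std b' _ zE zA) k_eps sb'.
rewrite eq_sym (negPf (Ii _ cb)) mul0r mulr0 add0r.
have [Ib|Ib] := leqP (height b') (I b); first by rewrite wcoord ?mulr0.
have [b2 cb2 sb2] := std_exists Ib; rewrite (wE.2 _ b' b2) ?mulr0 //.
  by apply: contraNneq (Ii _ cb) => e; rewrite -sb2 -e sb'.
have b2b' : b2 != b' by apply: contraNneq (Ii _ cb) => e; rewrite -sb2 e sb'.
by rewrite repl_same repl_other // ffunE sb2.
Qed.

End Flag.

(** * Dual bases *)

Section DualBasis.
Variables (F : fieldType) (V : vectType F) (n : nat) (e : n.-tuple V).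
Hypothesis e_basis : basis_of fullv e.

Definition dual_basis (i : 'I_n) : dualv V := linfun (coord e i : V -> F^o).
(** The coordinate function on V^* along [dual_basis i]; the two families are the [k] and the [eps]
    of adapted tensors. *)
Definition eval_basis (i : 'I_n) (xi : dualv V) : F := xi e`_i.

Lemma dual_basisE i v : dual_basis i v = coord e i v.
Proof. by rewrite lfunE. Qed.

Lemma eval_dual_basis i j : eval_basis i (dual_basis j) = (i == j)%:R.
Proof.
by rewrite /eval_basis dual_basisE coord_free ?(basis_free e_basis) // eq_sym.
Qed.

Lemma eval_basis_linear i a xi xi' :
  eval_basis i (a *: xi + xi') = a * eval_basis i xi + eval_basis i xi'.
Proof. by rewrite /eval_basis !lfunE /= lfunE. Qed.

Lemma dual_basis_span xi : xi = \sum_i eval_basis i xi *: dual_basis i.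
Proof.
apply/lfunP => v; rewrite {1}(coord_basis e_basis (memvf v)) linear_sum sum_lfunE.
apply: eq_bigr => i _; rewrite linearZ lfunE /= dual_basisE /eval_basis.
exact: mulrC.
Qed.

Lemma eval_basis_inj xi xi' : (forall i, eval_basis i xi = eval_basis i xi') -> xi = xi'.
Proof.
move=> E; rewrite [LHS]dual_basis_span [RHS]dual_basis_span.
by apply: eq_bigr => i _; rewrite E.
Qed.

Lemma exists_endo (u : 'I_n -> V) : exists g : 'End(V), forall i : 'I_n, g e`_i = u i.
Proof.
have [f fP] := linear_of_free e [tuple u i | i < n].
exists (linfun f) => i; rewrite lfunE /=.
have := fP (basis_free e_basis); rewrite !size_tuple => /(_ erefl).
move/(congr1 (nth 0 ^~ i)); rewrite (nth_map 0) ?size_tuple // => ->.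
by rewrite -tnth_nth tnth_mktuple.
Qed.
End DualBasis.

Lemma multilinear_scale (F : fieldType) (U : vectType F) s (x : tens U s) (a : box s -> F)
    (v : {ffun box s -> U}) :
  multilinear x -> x [ffun b => a b *: v b] = (\prod_b a b) * x v.
Proof.
move=> xl.
suff H (r : seq (box s)) : uniq r ->
    x [ffun b => if b \in r then a b *: v b else v b] = (\prod_(b <- r) a b) * x v.
  rewrite -[in RHS]big_enum -H ?enum_uniq //; congr (x _).
  by apply/ffunP => b; rewrite !ffunE mem_enum.
elim: r => [_|b r IHr /andP[br ur]].
  by rewrite big_nil mul1r; congr (x _); apply/ffunP => b; rewrite !ffunE.
rewrite big_cons -mulrA -IHr //.
set v' := [ffun b => if b \in r then _ else _].
rewrite -[in RHS](repl_id v' b) -(multilinearZ xl); congr (x _).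
apply/ffunP => b'; rewrite replE !ffunE inE (negPf br).
by case: eqP => // ->.
Qed.

(** * Conjugate partitions *)

Section Conjugate.

(** In a weakly decreasing list the entries larger than [c] form a prefix. *)
Lemma count_sorted (l : seq nat) (c j : nat) : sorted geq l ->
  (j < count (fun a => c < a) l)%N = (c < nth 0%N l j)%N.
Proof.
have geq_trans : transitive geq by move=> a b d ab da; apply: leq_trans da ab.
elim: l j => [|a l IHl] j; first by rewrite nth_nil.
rewrite /= (path_sortedE geq_trans) => /andP[/allP al sl].
have [ca|ac] := ltnP c a; first by case: j => [|j] /=; rewrite ?add1n ?ltnS ?IHl.
case: j => [|j] /=; rewrite add0n.
  rewrite [in RHS]ltnNge ac /=; apply/negbTE; rewrite -leqNgt leqn0 -leqn0 leqNgt -has_count.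
  by apply/hasPn => b /al ba; rewrite -leqNgt (leq_trans ba).
rewrite -IHl //.
suff -> : count (fun a => c < a)%N l = 0%N by [].
apply/eqP; rewrite -leqn0 leqNgt -has_count.
by apply/hasPn => b /al ba; rewrite -leqNgt (leq_trans ba).
Qed.

Variable la : intpart.

Lemma intpart_sorted : sorted geq la.
Proof. by case: la => l /= /andP[]. Qed.

Lemma nth_intpart_le j : (nth 0%N la j <= head 0%N la)%N.
Proof.
rewrite leqNgt -count_sorted ?intpart_sorted //.
case: (parts la) intpart_sorted => [|a l] //=; rewrite ltnn add0n => al.
rewrite -leqNgt (leq_trans _ (leq0n j)) // leqNgt -has_count; apply/hasPn => b bl.
rewrite -leqNgt; have geq_trans : transitive geq by move=> x y z xy zx; apply: leq_trans zx xy.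
by move: al; rewrite (path_sortedE geq_trans) => /andP[/allP/(_ b bl)].
Qed.

Lemma nth_conjp c j : (j < nth 0%N (conjp la) c)%N = (c < nth 0%N la j)%N.
Proof.
have [clt|cge] := ltnP c (head 0%N la).
  by rewrite nth_mkseq // count_sorted ?intpart_sorted.
rewrite nth_default ?size_mkseq // ltn0; apply/esym/negbTE; rewrite -leqNgt.
exact: leq_trans (nth_intpart_le j) cge.
Qed.

Lemma height_conjp (b : box (conjp la)) : (height b <= size la)%N.
Proof.
rewrite leqNgt /height nth_conjp nth_default //.
Qed.

Lemma sum_lt h m : (\sum_(0 <= r < h) (r < m) = minn h m)%N.
Proof.
elim: h => [|h IHh]; first by rewrite big_geq // min0n.
rewrite big_nat_recr //= IHh; lia.
Qed.

(** Double counting of the boxes in the first [k] rows, by columns and by rows. *)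
Lemma sum_rows k :
  (\sum_(b : box (conjp la)) (row_of b < k) = \sum_(0 <= j < k) nth 0 la j)%N.
Proof.
rewrite /row_of (sum_box _ (fun x => nat_of_bool (x.2 < k)%N)) /=.
transitivity (\sum_(0 <= c < size (conjp la)) \sum_(0 <= j < k) (c < nth 0 la j))%N.
  apply: eq_bigr => c _; rewrite sum_lt minnC -sum_lt.
  by apply: eq_bigr => j _; rewrite nth_conjp.
rewrite exchange_big; apply: eq_bigr => j _; rewrite sum_lt size_mkseq.
by apply/minn_idPr/nth_intpart_le.
Qed.
End Conjugate.

(** * Highest-weight vectors are adapted to their flag *)

Section HighestWeight.
Variables (F : numFieldType) (V : vectType F) (n : nat) (e : n.-tuple V).
Variable la : intpart.
Hypotheses (e_basis : basis_of fullv e) (la_le : (size la <= n)%N).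
Local Notation s := (conjp la).
Local Notation eps := (dual_basis e).

Lemma weight_content (x : tens (dualv V) s) (I : {ffun box s -> 'I_n}) (k : nat) :
  multilinear x -> highest_weight_vector e x -> (k <= n)%N ->
  x [ffun b => eps (I b)] != 0 ->
  (\sum_(b : box s) (I b < k) = \sum_(b : box s) (row_of b < k))%N.
Proof.
move=> xl [_ xw] kn xI; rewrite sum_rows.
(* With these eigenvalues both weights become powers of 2, whose exponents can be compared in
   characteristic zero. *)
pose t (j : nat) : F := if (j < k)%N then 2 else 1.
have [g gE] := exists_endo e_basis (fun i => t i *: e`_i).
have gU : upper_triangular e t g.
  move=> j; rewrite size_tuple => jn; split.
    by rewrite /t; case: ifP => _; rewrite ?oner_eq0 // pnatr_eq0.
  by rewrite (gE (Ordinal jn)) /= subrr mem0v.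
have := congr1 (fun y : tens (dualv V) s => y [ffun b => eps (I b)]) (xw t g gU).
rewrite /gact [RHS]/GRing.scale /=.
have -> : [ffun b => ([ffun b => eps (I b)] b \o g)%VF] =
          [ffun b => t (I b) *: [ffun b => eps (I b)] b].
  apply/ffunP => b; rewrite !ffunE; apply: (eval_basis_inj e_basis) => i.
  rewrite /eval_basis lfunE /= gE !lfunE /= linearZ /= !dual_basisE.
  rewrite coord_free ?(basis_free e_basis) //.
  by case: eqP => [->|_] //=; rewrite scaler0 mulr0.
rewrite multilinear_scale // => /(mulIf xI).
rewrite size_tuple.
have -> : \prod_(j < n) t j ^+ nth 0%N la j = 2 ^+ (\sum_(0 <= j < k) nth 0%N la j)%N.
  rewrite expr_sum big_mkord (big_ord_widen n (fun j => 2 ^+ nth 0%N la j) kn) [RHS]big_mkcond.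
  by apply: eq_bigr => j _; rewrite /t; case: ifP => _; rewrite ?expr1n.
have -> : \prod_b t (I b) = 2 ^+ (\sum_(b : box s) (I b < k))%N.
  by rewrite expr_sum; apply: eq_bigr => b _; rewrite /t; case: ifP.
by move/eqP; rewrite -!natrX eqr_nat eqn_exp2l // => /eqP.
Qed.

Lemma highest_weight_adapted (x : tens (dualv V) s) :
  ext (dualv V) s x -> highest_weight_vector e x -> flag_adapted (eval_basis e) x.
Proof.
move=> [xl xa] xw.
have xI (I : {ffun box s -> 'I_n}) b0 :
    (height b0 <= I b0)%N -> x [ffun b => eps (I b)] = 0.
  move=> Ib0; apply/eqP/negPn/negP => xI.
  have h0n : (height b0 <= n)%N := leq_trans (height_conjp b0) la_le.
  have sE := weight_content xl xw h0n xI.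
  have height_le (b : box s) : (height b <= n)%N := leq_trans (height_conjp b) la_le.
  set k := height b0 in sE h0n Ib0.
  have Iinj c : {in boxes_in_col s c &, injective I}.
    move=> b b'; rewrite !inE => /eqP cb /eqP cb' Ib; apply: contraNeq xI => bb'.
    by apply/eqP; apply: (xa _ b b'); rewrite ?cb ?cb' ?ffunE ?Ib.
  (* A column of height at most [k] lies within the first [k] rows; in a longer one the entries are
     distinct, so at most [k] of them are below [k]. *)
  have le c : (\sum_(b : box s | column b == c) (I b < k) <=
               \sum_(b : box s | column b == c) (row_of b < k))%N.
    have [hk|kh] := leqP (nth 0%N s c) k.
      apply: leq_sum => b /eqP cb; rewrite (leq_trans (row_lt b)) ?leq_b1 //.
      by rewrite /height cb.
    have card (Q : pred (box s)) : (\sum_(b : box s | column b == c) Q b =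
        #|[set b in boxes_in_col s c | Q b]%SET|)%N.
      rewrite -sum1dep_card big_mkcondr; apply: eq_bigl => b; rewrite inE //.
    rewrite !card -(card_in_imset (f := I)); last first.
      move=> b b'; rewrite !inE => /andP[bc _] /andP[b'c _].
      by apply: (Iinj c); rewrite inE.
    apply: leq_trans (leq_imset_card (std height_le) _); apply/subset_leq_card.
    apply/fintype.subsetP => _ /imsetP[b + ->]; rewrite !inE => /andP[/eqP cb Ib].
    have [|b' [cb' rb']] := @box_exists s c (I b); first exact: ltn_trans kh.
    apply/imsetP; exists b'; last exact: val_inj.
    by rewrite !inE cb' eqxx rb'.
  (* The totals agree, so the inequality is an equality in each column. The column of [b0] violates
     this: it has [k] boxes, and the entry of [b0] is not below [k]. *)
  have colE c : (c < size s)%N -> (\sum_(b : box s | column b == c) (I b < k) =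
                \sum_(b : box s | column b == c) (row_of b < k))%N.
    have := leqif_sum (fun (c : 'I_(size s)) (_ : true) => leqif_eq (le c)).
    rewrite (partition_big (fun b => Ordinal (column_lt b)) xpredT) //= in sE.
    rewrite [RHS](partition_big (fun b => Ordinal (column_lt b)) xpredT) //= in sE.
    rewrite sE => -[_]; rewrite eqxx => /esym/forallP H cs.
    by have /eqP := H (Ordinal cs).
  have := colE _ (column_lt b0).
  rewrite (bigD1 b0) //= [RHS](bigD1 b0) //= row_lt ltnNge Ib0 /= => /eqP.
  rewrite eqn_leq => /andP[_]; apply/negP; rewrite -ltnNge add0n add1n ltnS.
  apply: leq_sum => b /andP[/eqP cb _]; rewrite /k -(height_col cb) row_lt leq_b1 //.
move=> v b0 vb0.
rewrite -(repl_id v b0) [v b0](dual_basis_span e_basis) (multilinear_sum xl) big1 // => i _.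
have [ib0|b0i] := ltnP i (height b0); first by rewrite vb0 // mul0r.
(* The [i]-th term of the expansion is again multilinear in all boxes, [b0] included, so it may be
   tested on basis vectors. *)
pose y : tens (dualv V) s := fun v => eval_basis e i (v b0) * x (repl v b0 (eps i)).
rewrite -[LHS]/(y v); move: v {vb0}; apply: (multilinear_eq0 (dual_basis_span e_basis)).
  apply/multilinearP => v b a u u'; rewrite /y.
  have [->|bb0] := eqVneq b b0.
    by rewrite !repl_same !repl_repl eval_basis_linear mulrDl mulrA.
  rewrite !(repl_other _ _ (_ : b0 != b)) 1?eq_sym // !(replC _ _ _ bb0).
  by rewrite ((multilinearP x).1 xl) mulrDr mulrCA.
move=> I; rewrite /y ffunE eval_dual_basis //; case: eqP => [iI|_]; last by rewrite mul0r.
rewrite mul1r -(xI I b0) -?iI //; congr (x _).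
apply/ffunP => b; have [->|bb0] := eqVneq b b0; first by rewrite repl_same ffunE iI.
by rewrite repl_other.
Qed.
End HighestWeight.

(** * Polynomial identities at generic parameters *)

Lemma poly_nonroot (F : numFieldType) (D : {poly F}) : D != 0 -> exists t, D.[t] != 0.
Proof.
move=> D0; apply: contrapT => noroot.
have roots : all (root D) [seq i%:R | i <- iota 0 (size D)].
  apply/allP => t _; rewrite rootE; apply/negPn/negP => Dt; apply: noroot.
  by exists t.
have := max_poly_roots D0 roots; rewrite size_map size_iota ltnn map_inj_uniq ?iota_uniq.
  by move=> /(_ isT).
by move=> i j /eqP; rewrite eqr_nat => /eqP.
Qed.

(** The roots of [D] stand for the parameters at which a curve may leave the group or the cone. *)
Lemma poly_eq0_generic (F : numFieldType) (D Q : {poly F}) : D != 0 ->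
  (forall t, D.[t] != 0 -> Q.[t] = 0) -> Q = 0.
Proof.
move=> D0 DQ; apply/eqP/negPn/negP => Q0.
have [|t] := @poly_nonroot _ (D * Q); first by rewrite mulf_neq0.
by rewrite hornerM mulf_eq0 negb_or => /andP[/DQ -> /eqP].
Qed.

(** Passes from the group to its Lie algebra: on the curve (1 + tX).p in a module [W], the
    coefficient of t is X.p. *)
Lemma coef_in_subspace (F : numFieldType) (T : lmodType F) (W : set T) (D : {poly F})
    (N : nat) (x : nat -> T) : is_subspace W -> D != 0 ->
  (forall t, D.[t] != 0 -> W (\sum_(k < N) t ^+ k *: x k)) ->
  forall k, (k < N)%N -> W (x k).
Proof.
move=> [W0 WD]; have WZ a y : W y -> W (a *: y).
  by move=> Wy; rewrite -[_ *: _]addr0; apply: WD.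
elim: N D x => // N IHN D x D0 DW.
(* P(2t) - 2^N P(t) has no term of degree N. *)
have xlt k : (k < N)%N -> W (x k).
  move=> kN; pose c k : F := 2 ^+ k - 2 ^+ N.
  have c0 : c k != 0.
    by rewrite subr_eq0 -!natrX eqr_nat eqn_exp2l // neq_ltn kN.
  rewrite -[x k]scale1r -(mulVf c0) -scalerA; apply: WZ.
  have D20 : D * (D \Po (2 *: 'X)) != 0.
    rewrite mulf_neq0 // -size_poly_eq0 size_comp_poly2 ?size_poly_eq0 //.
    by rewrite size_scale ?size_polyX // pnatr_eq0.
  apply: (IHN _ (fun k => c k *: x k) D20) kN => t.
  rewrite hornerM horner_comp !hornerE mulf_eq0 negb_or => /andP[Dt D2t].
  have := WD (- 2 ^+ N) _ _ (DW _ Dt) (DW _ D2t).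
  congr (W _); rewrite !big_ord_recr /= scalerDr !scalerA addrACA.
  rewrite exprMn mulNr !scaleNr addNr addr0 scaler_sumr -sumrN -big_split /=.
  apply: eq_bigr => j _; rewrite !scalerA -scaleNr -scalerDl exprMn /c.
  by congr (_ *: _); ring.
(* The top coefficient is left after subtracting the others, at a nonzero t that is not a root of
   [D]. *)
move=> k; rewrite ltnS leq_eqVlt => /orP[/eqP->|]; last exact: xlt.
have [|t] := @poly_nonroot _ (D * 'X); first by rewrite mulf_neq0 ?polyX_eq0.
rewrite hornerM hornerX mulf_eq0 negb_or => /andP[Dt t0].
rewrite -[x N]scale1r -(mulVf (expf_neq0 N t0)) -scalerA; apply: WZ.
have := DW _ Dt; rewrite big_ord_recr /= => H.
have Ws : W (\sum_(i < N) t ^+ i *: x i).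
  by elim/big_rec: _ => [|i y _ Wy] //; apply: WD => //; apply: xlt.
have := WD (-1) _ _ Ws H; rewrite scaleN1r addrA addNr add0r //.
Qed.

(** * Differentials and Zariski tangent vectors *)

Section Differential.
Variables (F : fieldType) (m : nat).
Implicit Types (v u : 'I_m -> F) (q : mpoly.mpoly m F).

(** The differential of [q] at [v] in the direction [u], as it occurs in [zariski_tangent]. *)
Definition mdiff v u q : F := \sum_(i < m) mpoly.meval v (mpoly.mderiv i q) * u i.

Lemma mdiffC v u a : mdiff v u (mpoly.mpolyC m a) = 0.
Proof.
by rewrite /mdiff big1 // => i _; rewrite mpoly.mderivC mpoly.meval0 mul0r.
Qed.

Lemma mdiffD v u q1 q2 : mdiff v u (q1 + q2) = mdiff v u q1 + mdiff v u q2.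
Proof.
rewrite /mdiff -big_split; apply: eq_bigr => i _ /=.
by rewrite mpoly.mderivD mpoly.mevalD mulrDl.
Qed.

Lemma mdiffM v u q1 q2 :
  mdiff v u (q1 * q2) = mdiff v u q1 * mpoly.meval v q2 + mpoly.meval v q1 * mdiff v u q2.
Proof.
rewrite /mdiff mulr_suml mulr_sumr -big_split; apply: eq_bigr => i _ /=.
by rewrite mpoly.mderivM mpoly.mevalD !mpoly.mevalM mulrDl mulrAC -!mulrA.
Qed.

Lemma mdiffX v u i : mdiff v u (mpoly.mpolyX F (mpoly.mnm1 i)) = u i.
Proof.
rewrite /mdiff (bigD1 i) //= big1 ?addr0 => [|j ji]; rewrite mpoly.mderivX mpoly.mnm1E.
  rewrite eqxx scale1r mpoly.mevalX big1 ?mul1r // => k _.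
  by rewrite mpoly.mnmBE subnn expr0.
by rewrite eq_sym (negPf ji) scale0r mpoly.meval0 mul0r.
Qed.

(** The chain rule along a polynomial curve. The property is stable under sums and products, so
    constants and variables suffice. *)
Lemma mpoly_curve (c : 'I_m -> {poly F}) q :
  exists Q : {poly F}, (forall t, Q.[t] = mpoly.meval (fun i => (c i).[t]) q) /\
    forall t, Q^`().[t] = mdiff (fun i => (c i).[t]) (fun i => (c i)^`().[t]) q.
Proof.
pose P q := exists Q : {poly F}, (forall t, Q.[t] = mpoly.meval (fun i => (c i).[t]) q) /\
    forall t, Q^`().[t] = mdiff (fun i => (c i).[t]) (fun i => (c i)^`().[t]) q.
have PC a : P (mpoly.mpolyC m a).
  exists a%:P; split=> t; first by rewrite hornerC mpoly.mevalC.
  by rewrite derivC horner0 mdiffC.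
have PD q1 q2 : P q1 -> P q2 -> P (q1 + q2).
  move=> [Q1 [Q1e Q1d]] [Q2 [Q2e Q2d]]; exists (Q1 + Q2); split=> t.
    by rewrite hornerD mpoly.mevalD Q1e Q2e.
  by rewrite derivD hornerD Q1d Q2d mdiffD.
have PM q1 q2 : P q1 -> P q2 -> P (q1 * q2).
  move=> [Q1 [Q1e Q1d]] [Q2 [Q2e Q2d]]; exists (Q1 * Q2); split=> t.
    by rewrite hornerM mpoly.mevalM Q1e Q2e.
  by rewrite derivM hornerD !hornerM Q1d Q2d Q1e Q2e mdiffM.
have PXn i d : P (mpoly.mpolyX F (mpoly.mnm1 i) ^+ d).
  elim: d => [|d IHd]; first by rewrite expr0 -mpoly.mpolyC1; apply: PC.
  rewrite exprS; apply: (PM) => //; exists (c i).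
  by split=> t; rewrite ?mpoly.mevalXU ?mdiffX.
apply: (mpoly.mpolyind (P := P)) => [|a m' q' _ _ Pq'].
  by rewrite -mpoly.mpolyC0; apply: PC.
apply: (PD) Pq'; rewrite -mpoly.mul_mpolyC; apply: (PM); first exact: PC.
rewrite mpoly.mpolyXE_id.
apply: big_ind => [||i _]; last exact: PXn; last exact: PM.
by rewrite -mpoly.mpolyC1; apply: PC.
Qed.

End Differential.

(** Along the curve, a polynomial that vanishes on [Z] becomes a polynomial in t that is zero at
    generic t, hence zero. Its derivative at 0 is the differential at [x 0] applied to [x 1]. *)
Lemma zariski_tangent_curve (F : numFieldType) (T : lmodType F) (S Z : set T)
    (D : {poly F}) (N : nat) (x : nat -> T) : D != 0 ->
  (forall t, D.[t] != 0 -> Z (\sum_(k < N.+2) t ^+ k *: x k)) -> S (x 1) ->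
  zariski_tangent S Z (x 0) (x 1).
Proof.
move=> D0 DZ Sx; split=> // m l q qZ.
pose c i := \poly_(k < N.+2) l i (x k).
have [Q [Qe Qd]] := mpoly_curve c q.
have cE t i : (c i).[t] = l i (\sum_(k < N.+2) t ^+ k *: x k).
  rewrite horner_poly linear_sum; apply: eq_bigr => k _.
  by rewrite linearZ /= mulrC.
have Q0 : Q = 0.
  apply: (poly_eq0_generic D0) => t Dt; rewrite Qe -[RHS](qZ _ (DZ t Dt)).
  by apply: mpoly.meval_eq => i; rewrite cE.
have := Qd 0; rewrite Q0 deriv0 horner0 => /esym; apply: etrans.
apply: eq_bigr => i _; congr (_ * _).
  by apply: mpoly.meval_eq => j; rewrite horner_coef0 coef_poly.
by rewrite horner_coef0 coef_deriv coef_poly.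
Qed.

Lemma zariski_tangent_comb (F : fieldType) (T : lmodType F) (S Z : set T) (p : T) a w w' :
  is_subspace S -> zariski_tangent S Z p w -> zariski_tangent S Z p w' ->
  zariski_tangent S Z p (a *: w + w').
Proof.
move=> [_ SD] [Sw wT] [Sw' w'T]; split=> [|m l q qZ]; first exact: SD.
apply: (etrans _ (_ : a * 0 + 0 = 0)); last by rewrite mulr0 addr0.
rewrite -[X in _ = a * X + _](wT m l q qZ) -[X in _ = _ + X](w'T m l q qZ) mulr_sumr -big_split /=.
by apply: eq_bigr => i _; rewrite linearP /= mulrDr mulrCA.
Qed.

(** The test polynomial is sum_j a_j X_j Y_j in two blocks of variables, for which the forms [f] and
    [g] are substituted. *)
Lemma zariski_tangent_quadric (F : fieldType) (T : lmodType F) (S Z : set T) (p w : T)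
    (J : finType) (a : J -> F) (f g : J -> {scalar T}) :
  (forall z, Z z -> \sum_j a j * (f j z * g j z) = 0) ->
  zariski_tangent S Z p w ->
  \sum_j a j * (f j w * g j p + f j p * g j w) = 0.
Proof.
move=> fgZ [_ wT].
pose l (i : 'I_(#|J| + #|J|)) : {scalar T} :=
  match fintype.split i with inl j => f (enum_val j) | inr j => g (enum_val j) end.
pose X i : mpoly.mpoly (#|J| + #|J|) F := mpoly.mpolyX F (mpoly.mnm1 i).
pose q : mpoly.mpoly (#|J| + #|J|) F := \sum_j
  mpoly.mpolyC _ (a j) * (X (lshift _ (enum_rank j)) * X (rshift _ (enum_rank j))).
have lf j : l (lshift _ (enum_rank j)) = f j.
  by rewrite /l (unsplitK (inl _)) enum_rankK.
have lg j : l (rshift _ (enum_rank j)) = g j.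
  by rewrite /l (unsplitK (inr _)) enum_rankK.
have /(wT _ l) : forall z, Z z -> mpoly.meval (fun i => l i z) q = 0.
  move=> z /fgZ <-; rewrite (big_morph _ (mpoly.mevalD _) (mpoly.meval0 _)).
  by apply: eq_bigr => j _; rewrite !mpoly.mevalM mpoly.mevalC !mpoly.mevalXU lf lg.
rewrite -/(mdiff (fun j => l j p) (fun j => l j w) q).
rewrite (big_morph _ (mdiffD _ _) (_ : mdiff _ _ 0 = 0)); last by rewrite -mpoly.mpolyC0 mdiffC.
move=> q0; rewrite -[RHS]q0; apply: eq_bigr => j _.
by rewrite !mdiffM mdiffC !mdiffX mpoly.mevalC !mpoly.mevalXU lf lg mul0r add0r.
Qed.

(** * Curves in the group and their orbits *)

Section Curve.
Variables (F : fieldType) (U : vectType F) (s : seq nat) (x : tens U s).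
Variable (Y : U -> U).
Hypothesis xl : multilinear x.

(** One [Q] serves all [v], with a uniform bound on the size, so that its coefficients are functions
    of [v], that is, tensors. The bound leaves room for the coefficient of t even when [r] is
    empty. *)
Lemma multilinear_curve_coef (r : seq (box s)) : uniq r ->
  exists Q : {ffun box s -> U} -> {poly F}, forall v,
    [/\ (size (Q v) <= (size r).+2)%N,
        forall t, x [ffun b => if b \in r then v b + t *: Y (v b) else v b] = (Q v).[t],
        (Q v)`_0 = x v & (Q v)`_1 = \sum_(b <- r) x (repl v b (Y (v b)))].
Proof.
elim: r => [_|b r IHr /andP[br ur]].
  exists (fun v => (x v)%:P) => v; split.
  - exact: leq_trans (size_polyC_leq1 _) _.
  - by move=> t; rewrite hornerC; congr (x _); apply/ffunP => b; rewrite ffunE.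
  - by rewrite coefC.
  - by rewrite coefC big_nil.
have [Q QP] := IHr ur; exists (fun v => Q v + Q (repl v b (Y (v b))) * 'X) => v.
have [Qs Qe Q0 Q1] := QP v; have [Qs' Qe' Q0' _] := QP (repl v b (Y (v b))).
split.
- apply: leq_trans (size_polyD _ _) _; rewrite geq_max leqW //=.
  by apply: leq_trans (size_polyMleq _ _) _; rewrite size_polyX addn2.
- move=> t; set h := [ffun b0 => if b0 \in r then v b0 + t *: Y (v b0) else v b0] in Qe *.
  have hb : h b = v b by rewrite ffunE (negPf br).
  have -> : [ffun b0 => if b0 \in b :: r then v b0 + t *: Y (v b0) else v b0] =
            repl h b (t *: Y (v b) + v b).
    apply/ffunP => k; rewrite replE !ffunE inE.
    by case: eqP => [->|//]; rewrite addrC.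
  rewrite ((multilinearP x).1 xl) hornerD hornerM hornerX -Qe -Qe' -{2}hb repl_id addrC.
  rewrite mulrC; congr (_ + x _ * _).
  apply/ffunP => k; rewrite !replE !ffunE.
  by case: eqP => // ->; rewrite (negPf br).
- by rewrite coefD coefMX addr0.
- by rewrite coefD coefMX /= Q1 Q0' big_cons addrC.
Qed.

Lemma deract_curve : exists (N : nat) (y : nat -> tens U s),
  [/\ y 0 = x, y 1 = deract Y x &
      forall t, (fun v : {ffun box s -> U} => x [ffun b => v b + t *: Y (v b)]) =
        \sum_(k < N.+2) t ^+ k *: y k].
Proof.
have [Q QP] := multilinear_curve_coef (enum_uniq (box s)).
exists (size (enum (box s))), (fun k v => (Q v)`_k); split.
- by apply/funext => v; have [_ _ ->] := QP v.
- by apply/funext => v; have [_ _ _ ->] := QP v; rewrite big_enum.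
move=> t; apply/funext => v; have [Qs Qe _ _] := QP v.
rewrite fct_sumE (eq_bigr (fun k : 'I_(size (enum (box s))).+2 => (Q v)`_k * t ^+ k)); last first.
  by move=> k _; rewrite mulrC.
rewrite -horner_coef_wide // -Qe; congr (x _).
by apply/ffunP => b; rewrite !ffunE mem_enum.
Qed.
End Curve.

Section Gact.
Variables (F : fieldType) (V : vectType F).

Lemma gact_curve s (x : tens (dualv V) s) (X : 'End(V)) : multilinear x ->
  exists (N : nat) (y : nat -> tens (dualv V) s),
  [/\ y 0 = x, y 1 = deract (fun xi => xi \o X)%VF x &
      forall t, gact (\1 + t *: X)%VF x = \sum_(k < N.+2) t ^+ k *: y k].
Proof.
move=> xl; have [N [y [y0 y1 yt]]] := deract_curve (fun xi : dualv V => xi \o X)%VF xl.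
exists N, y; split=> // t; rewrite -yt; apply/funext => v; rewrite /gact; congr (x _).
apply/ffunP => b; rewrite !ffunE; apply/lfunP => u.
by rewrite !lfunE /= !lfunE /= !lfunE /= linearD linearZ.
Qed.

(** Take for [D] the determinant of 1 + tM, with M the matrix of [X]; its value at 0 is 1. *)
Lemma isGL_generic (X : 'End(V)) :
  exists2 D : {poly F}, D != 0 & forall t, D.[t] != 0 -> isGL (\1 + t *: X)%VF.
Proof.
pose e := vbasis {:V}; have e_basis : basis_of fullv e := vbasisP fullv.
pose M := \matrix_(i < \dim {:V}, j < \dim {:V}) coord e j (X e`_i).
pose D := \det (1%:M + 'X *: map_mx polyC M).
have DE t : D.[t] = \det (1%:M + t *: M).
  rewrite -horner_evalE -det_map_mx; congr (\det _).
  apply/matrixP => i j; rewrite !mxE /= horner_evalE !hornerE /= hornerMn !hornerE.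
  done.
exists D.
  apply/eqP => D0; have := DE 0; rewrite D0 horner0 scale0r addr0 det1.
  by move/eqP; rewrite eq_sym oner_eq0.
move=> t; rewrite DE => Dt; apply/lker0P => u u'.
have lfE w : (\1 + t *: X)%VF w = w + t *: X w by rewrite lfunE /= id_lfunE lfunE.
rewrite !lfE => uu'; apply/eqP; rewrite -subr_eq0.
have: (u - u') + t *: X (u - u') = 0.
  by rewrite linearB scalerBr addrACA -opprD uu' subrr.
move: (u - u') => v vker {u u' uu'}.
pose c := \row_j coord e j v.
have cM : c *m (1%:M + t *: M) = 0.
  apply/rowP => j; rewrite mulmxDr mulmx1 -scalemxAr !mxE -[RHS](linear0 (coord e j)) -vker.
  rewrite linearD linearZ /=; congr (_ + _ * _).
  rewrite (coord_basis e_basis (memvf v)) !linear_sum /=.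
  by apply: eq_bigr => i _; rewrite [c _ _]mxE mxE !linearZ.
have c0 : c = 0.
  by rewrite -[c](mulmxK (_ : 1%:M + t *: M \in unitmx)) ?cM ?mul0mx // unitmxE unitfE.
rewrite (coord_basis e_basis (memvf v)) big1 // => i _.
by have := congr1 (fun r : 'rV_(\dim {:V}) => r 0 i) c0; rewrite !mxE => ->; rewrite scale0r.
Qed.
End Gact.

(** * Schur modules and the flag variety *)

Section SchurModules.
Variables (F : fieldType) (V : vectType F) (la : intpart).
Local Notation s := (conjp la).

Lemma gact_comp (g h : 'End(V)) (x : tens (dualv V) s) :
  gact h (gact g x) = gact (h \o g)%VF x.
Proof.
apply/funext => v; rewrite /gact; congr (x _).
by apply/ffunP => b; rewrite !ffunE comp_lfunA.
Qed.

Lemma isGL_comp (g h : 'End(V)) : isGL g -> isGL h -> isGL (h \o g)%VF.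
Proof.
move=> /lker0P gi /lker0P hi; apply/lker0P => u v; rewrite !comp_lfunE => /hi/gi //.
Qed.

(** [schur] is a choice with default {0}, so a nonzero element shows that the choice succeeded. *)
Lemma schur_spec (x : tens (dualv V) s) : schur V la x -> x <> 0 ->
  schur V la `<=` ext (dualv V) s /\ submodule (@gact _ V s) (schur V la).
Proof.
by rewrite /schur; case: xgetP => [W _ [Wext [Wsub _ _] _]|_ ->].
Qed.

Lemma schurd_multilinear (f : tens V s) : schurd V la f -> multilinear f.
Proof.
rewrite /schurd; case: xgetP => [W _ [Wext _ _] /Wext[] //|_ ->].
by move=> v b a u u'; rewrite mulr0 addr0.
Qed.

Lemma schurd0 : schurd V la 0.
Proof. by rewrite /schurd; case: xgetP => [W _ [_ [[]]]|_]. Qed.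

Lemma flag_variety_gact (x : tens (dualv V) s) (g : 'End(V)) :
  flag_variety V la x -> isGL g -> flag_variety V la (gact g x).
Proof.
move=> [e [v [h [c [eb Sv hGL c0 ->]]]]] gGL.
exists e, v, (g \o h)%VF, c; split=> //; first exact: isGL_comp.
by rewrite -gact_comp.
Qed.

Lemma flag_varietyZ (x : tens (dualv V) s) a : a != 0 ->
  flag_variety V la x -> flag_variety V la (a *: x).
Proof.
move=> a0 [e [v [h [c [eb Sv hGL c0 ->]]]]].
by exists e, v, h, (a * c); rewrite mulf_neq0 // scalerA.
Qed.

Lemma flag_variety_schur (x : tens (dualv V) s) : flag_variety V la x ->
  [/\ x <> 0, schur V la x, schur V la `<=` ext (dualv V) s &
      submodule (@gact _ V s) (schur V la)].
Proof.
move=> [e [v [h [c [eb [Sv [v0 vw]] hGL c0 ->]]]]].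
have [Sext Ssub] := schur_spec Sv v0; split=> //; last first.
  by rewrite -[_ *: _]addr0; apply: Ssub.1.2; [apply: Ssub.2|apply: Ssub.1.1].
move=> cv0; apply: v0; apply/funext => xi.
have := congr1 (fun y : tens (dualv V) s => y [ffun b => (xi b \o h^-1)%VF]) cv0.
rewrite /gact [LHS]/GRing.scale /= => /eqP; rewrite mulf_eq0 (negPf c0) /= => /eqP.
apply: etrans; congr (v _); apply/ffunP => b; rewrite !ffunE.
by rewrite -comp_lfunA lker0_compVf // comp_lfun1r.
Qed.

End SchurModules.

Section FlagVariety.
Variables (F : numFieldType) (V : vectType F) (la : intpart).
Local Notation s := (conjp la).
Hypothesis la_le : (size la <= \dim {:V})%N.

(** A highest-weight vector is adapted to its basis [e0], and its translate by [h] to the basis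
    [h e0]; scaling changes nothing. *)
Lemma flag_variety_adapted (x : tens (dualv V) s) : flag_variety V la x ->
  exists e : (\dim {:V}).-tuple V,
    basis_of fullv e /\ flag_adapted (eval_basis e) x.
Proof.
move=> [e0 [v [h [c [eb [Sv vw] hGL c0 ->]]]]].
have e0n : size e0 == \dim {:V} by case/andP: (eb) => /eqP <- /eqnP ->.
pose e := Tuple e0n; have e_basis : basis_of fullv e := eb.
have [Sext _] := schur_spec Sv vw.1.
have vA := highest_weight_adapted e_basis la_le (Sext _ Sv) vw.
exists (map_tuple h e); split.
  have := limg_basis_of (f := h) _ e_basis; rewrite (eqP hGL) capv0 => /(_ erefl).
  by rewrite lker0_limgf.
move=> xi b xib; rewrite -[RHS](mulr0 c); congr (_ * _); rewrite /gact.
apply: (vA _ b) => i ib; rewrite ffunE -[RHS](xib i ib) /eval_basis comp_lfunE.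
by rewrite (nth_map 0) ?size_tuple.
Qed.

(** Evaluation packaged as a linear form, to be substituted into the polynomials of
    [zariski_tangent]. *)
Definition eval_tens (xi : {ffun box s -> dualv V}) (x : tens (dualv V) s) : F := x xi.
Fact eval_tens_linear xi : linear_for *%R (eval_tens xi).
Proof. by []. Qed.
HB.instance Definition _ xi := GRing.isLinear.Build F (tens (dualv V) s) F *%R
  (eval_tens xi) (eval_tens_linear xi).

Lemma height_conjp_dim (b : box s) : (height b <= \dim {:V})%N.
Proof. exact: leq_trans (height_conjp b) la_le. Qed.

Lemma affine_tangent_plucker (p w : tens (dualv V) s) :
  affine_tangent la p w -> plucker_tangent p w.
Proof.
move=> wT xi eta b' c hb'.
(* The quadric is the difference of the two sides of the exchange relation: the boxes of column [c]
   index its left side, and the unit its right side, with coefficient -1. *)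
pose a (j : box s + unit) : F := if j is inl b then (column b == c)%:R else -1.
pose f (j : box s + unit) : {scalar (tens (dualv V) s)} :=
  if j is inl b then eval_tens (repl xi b (eta b')) else eval_tens xi.
pose g (j : box s + unit) : {scalar (tens (dualv V) s)} :=
  if j is inl b then eval_tens (repl eta b' (xi b)) else eval_tens eta.
have exch z : flag_cone V la z -> \sum_j a j * (f j z * g j z) = 0.
  move=> Zz; rewrite big_sumType /= (big_pred1 tt); last by case.
  rewrite /eval_tens mulN1r; apply/eqP; rewrite subr_eq0; apply/eqP.
  case: Zz => [->|Zz].
    have t0 v : (0 : tens (dualv V) s) v = 0 by [].
    by rewrite !t0 mul0r big1 // => b _; rewrite mulr0.
  have [e [eb zA]] := flag_variety_adapted Zz.
  have [_ Sz Sext _] := flag_variety_schur Zz.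
  rewrite -(plucker_exchange (dual_basis_span eb) (eval_dual_basis eb) height_conjp_dim
    (Sext _ Sz) zA xi eta hb') [RHS]big_mkcond.
  by apply: eq_bigr => b _; case: ifP => _; rewrite ?mul1r ?mul0r.
have := zariski_tangent_quadric exch wT.
rewrite big_sumType /= (big_pred1 tt); last by case.
rewrite /eval_tens mulN1r => /eqP; rewrite subr_eq0 => /eqP <-.
rewrite big_mkcond; apply: eq_bigr => b _.
by case: ifP => _; rewrite ?mul1r ?mul0r.
Qed.

End FlagVariety.

(** * The pairing of tensors of equal shape *)

Section Pairing.
Variables (F : fieldType) (V : vectType F).

Local Notation Idx s := {ffun box s -> 'I_(\dim {:V})}.

Definition pairing (s : seq nat) (f : tens V s) (x : tens (dualv V) s) : F :=
  \sum_(I : Idx s)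
    f [ffun k => evec (I k)] * x [ffun k => covec (I k)].

Lemma apolar_self (la : intpart) (f : tens V (conjp la)) (x : tens (dualv V) (conjp la)) :
  apolar f x = fun=> (\prod_(k <- conjp la) k`!%:R)^-1 * pairing f x.
Proof.
have la_la : part_sub la la by apply/allP => i _; exact: leqnn.
rewrite /apolar la_la; apply/funext => xi; rewrite /contraction; congr (_ * _).
apply: eq_bigr => I _; congr (_ * x _); apply/ffunP => b; rewrite [LHS]ffunE.
case E : (val b) => [c r].
have -> : insub (c, r) = Some b :> option (seq_sub (cells (conjp la))) by rewrite -E valK.
by [].
Qed.

(** In each box, [X] is moved from [f] to [x] by means of its matrix M: X e_j = sum_i M_ij e_i and
    e^i o X = sum_j M_ij e^j. The sign is that of the dual action. *)
Lemma pairing_deract (s : seq nat) (X : 'End(V)) (f : tens V s) (x : tens (dualv V) s) :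
  multilinear f -> multilinear x ->
  pairing (gl_actd X f) x = - pairing f (deract (fun xi => xi \o X)%VF x).
Proof.
move=> fl xl; rewrite /pairing -sumrN.
pose M i j := covec i (X (evec j)).
pose e (I : Idx s) : {ffun box s -> V} := [ffun k => evec (I k)].
pose ee (I : Idx s) : {ffun box s -> dualv V} :=
  [ffun k => covec (I k)].
have vb := vbasisP {:V}.
have Xe j : X (evec j) = \sum_i M i j *: evec i.
  rewrite [LHS](coord_basis vb (memvf _)); apply: eq_bigr => i _.
  by rewrite /M dual_basisE.
have eX i : (covec i \o X)%VF = \sum_j M i j *: covec j.
  rewrite [LHS](dual_basis_span vb); apply: eq_bigr => j _.
  by rewrite /eval_basis comp_lfunE.
have repl_e I b j : repl (e I) b (evec j) = e (repl I b j).
  by apply/ffunP => k; rewrite replE !ffunE replE !ffunE; case: eqP.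
have repl_ee I b j : repl (ee I) b (covec j) = ee (repl I b j).
  by apply/ffunP => k; rewrite replE !ffunE replE !ffunE; case: eqP.
transitivity (- \sum_b \sum_(I : Idx s) f (repl (e I) b (X (evec (I b)))) * x (ee I)).
  rewrite exchange_big -sumrN; apply: eq_bigr => I _; rewrite /gl_actd mulNr mulr_suml.
  by congr (- _); apply: eq_bigr => b _; rewrite replE !ffunE.
transitivity (- \sum_b \sum_(I : Idx s) f (e I) * x (repl (ee I) b (covec (I b) \o X)%VF)); last first.
  rewrite exchange_big -sumrN; apply: eq_bigr => I _; rewrite /deract mulr_sumr.
  by congr (- _); apply: eq_bigr => b _; rewrite /ee ffunE.
congr (- _); apply: eq_bigr => b _.
transitivity (\sum_(I : Idx s) \sum_j M j (I b) * f (e (repl I b j)) * x (ee I)).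
  apply: eq_bigr => I _; rewrite Xe (multilinear_sum fl) mulr_suml.
  by apply: eq_bigr => j _; rewrite repl_e.
transitivity (\sum_(I : Idx s) \sum_j M (I b) j * f (e I) * x (ee (repl I b j))); last first.
  apply: eq_bigr => I _; rewrite eX (multilinear_sum xl) mulr_sumr.
  by apply: eq_bigr => j _; rewrite repl_ee mulrA [f _ * _]mulrC.
rewrite !pair_big /=.
(* Both sides are sums over a filling and one more index; trading that index with the entry of [b]
   matches their terms. *)
pose h (Ij : Idx s * 'I_(\dim {:V})) :=
  (repl Ij.1 b Ij.2, Ij.1 b).
have hK : involutive h.
  by move=> [I j]; rewrite /h /= repl_repl repl_id repl_same.
rewrite (reindex_inj (inv_inj hK)) /=; apply: eq_bigr => -[I j] _ /=.
by rewrite repl_repl repl_id repl_same.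
Qed.

Lemma pairing_comb (s : seq nat) (f : tens V s) (x y : tens (dualv V) s) a :
  pairing f (a *: x + y) = a * pairing f x + pairing f y.
Proof.
rewrite /pairing mulr_sumr -big_split; apply: eq_bigr => I _ /=.
by rewrite !fctE /= mulrDr /GRing.scale /= mulrCA.
Qed.

End Pairing.

(** * The tangent space at a point of the flag variety *)

Section Tangent.
Variables (F : numFieldType) (V : vectType F) (la : intpart) (p : tens (dualv V) (conjp la)).
Local Notation s := (conjp la).
Hypotheses (la_le : (size la <= \dim {:V})%N) (Pp : flag_variety V la p).

Lemma schur_deract (X : 'End(V)) : schur V la (deract (fun xi => xi \o X)%VF p).
Proof.
have [_ Sp Sext Ssub] := flag_variety_schur Pp.
have [N [y [_ <- yt]]] := gact_curve X (Sext _ Sp).1.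
have [D D0 DGL] := isGL_generic X.
apply: (coef_in_subspace (N := N.+2) Ssub.1 D0) => // t Dt.
by rewrite -yt; apply: Ssub.2 => //; apply: DGL.
Qed.

Lemma tangent_deract (X : 'End(V)) : affine_tangent la p (deract (fun xi => xi \o X)%VF p).
Proof.
have Xp := schur_deract X.
have [_ Sp Sext Ssub] := flag_variety_schur Pp.
have [N [y [y0 y1 yt]]] := gact_curve X (Sext _ Sp).1.
have [D D0 DGL] := isGL_generic X.
rewrite /affine_tangent -{1}y0 -y1; apply: (zariski_tangent_curve (N := N) D0).
  by move=> t Dt; right; rewrite -yt; apply: flag_variety_gact => //; apply: DGL.
by rewrite y1.
Qed.

Lemma tangent_point : affine_tangent la p p.
Proof.
have [_ Sp _ _] := flag_variety_schur Pp.
(* The curve (1 + t) p stays in the cone for t other than -1. *)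
apply: (zariski_tangent_curve (N := 0) (D := 1 + 'X) (x := fun=> p)) => //.
  by apply/eqP => /(congr1 (fun q : {poly F} => q.[0])) /eqP; rewrite !hornerE oner_eq0.
move=> t; rewrite !hornerE => t0; right.
rewrite big_ord_recr /= big_ord1 -scalerDl expr0 expr1.
exact: flag_varietyZ.
Qed.

(** The matrix from [tangent_coords] defines an X for which X.p has the coordinates of [w] at [stdv]
    with one entry beyond the height, and [d] corrects the coordinate at [stdv]. The difference is
    tangent, and [plucker_tangent_eq0] shows that it is zero. *)
Lemma tangent_decomposition (w : tens (dualv V) s) : affine_tangent la p w ->
  exists (X : 'End(V)) (d : F), w = d *: p + deract (fun xi => xi \o X)%VF p.
Proof.
move=> wT; have [p0 Sp Sext Ssub] := flag_variety_schur Pp.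
have [e [eb pA]] := flag_variety_adapted la_le Pp.
have hle := height_conjp_dim la_le.
have pE := Sext _ Sp; have wE := Sext _ wT.1.
have span := dual_basis_span eb; have ev := eval_dual_basis eb.
have pstd : p (stdv (dual_basis e) hle) != 0.
  exact: (adapted_std_neq0 span ev).
have [A AP] := tangent_coords span ev pE pA (affine_tangent_plucker la_le wT) pstd.
have [X XE] := exists_endo eb (fun r => \sum_j A r j *: e`_j).
have eXe i j : eval_basis e i (dual_basis e j \o X)%VF = A i j.
  rewrite /eval_basis comp_lfunE XE linear_sum (bigD1 j) //= big1 => [|k kj].
    by rewrite linearZ /= dual_basisE coord_free ?(basis_free eb) // eqxx addr0 [LHS]mulr1.
  by rewrite linearZ /= dual_basisE coord_free ?(basis_free eb) // (negPf kj) scaler0.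
exists X.
set Xp := deract _ p.
set v0 := stdv _ _ in pstd AP.
exists ((w v0 - Xp v0) / p v0).
set d := _ / _.
have w'T : affine_tangent la p ((-1) *: (d *: p + Xp) + w).
  apply: zariski_tangent_comb => //; first exact: Ssub.1.
  by apply: zariski_tangent_comb (tangent_point) (tangent_deract X); exact: Ssub.1.
suff: (-1) *: (d *: p + Xp) + w = 0.
  by rewrite scaleN1r addrC => /eqP; rewrite subr_eq0 => /eqP.
have w'E v : ((-1) *: (d *: p + Xp) + w) v = w v - d * p v - Xp v.
  rewrite -[LHS]/(-1 * (d * p v + Xp v) + w v); ring.
apply: (plucker_tangent_eq0 span ev pE pA pstd (Sext _ w'T.1) (affine_tangent_plucker la_le w'T)).
  rewrite w'E divfK //; ring.
move=> b j bj; rewrite w'E (AP b j bj) /Xp (deract_std span ev hle _ pE pA bj) eXe.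
have -> : p (repl v0 b (dual_basis e j)) = 0.
  by rewrite (adapted_eps_at ev pA bj) ?repl_same.
ring.
Qed.

End Tangent.

(** * The geometric square in degree la *)

Section GeometricSquare.
Variables (F : numFieldType) (V : vectType F).

Lemma apolar0 (mu la : intpart) (x : tens (dualv V) (conjp la)) :
  apolar (0 : tens V (conjp mu)) x = 0.
Proof.
rewrite /apolar; case: ifP => // _; apply/funext => xi; rewrite /contraction.
by rewrite [X in _ * X]big1 ?mulr0 // => I _; apply: mul0r.
Qed.

Lemma gl_actd0 (s : seq nat) (X : 'End(V)) : gl_actd X (0 : tens V s) = 0.
Proof.
by apply/funext => v; rewrite /gl_actd big1 ?oppr0.
Qed.

Lemma inclusion_in (la : intpart) (f : tens V (conjp la)) : @inclusion F V la f la = f.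
Proof. exact: dfwith_in. Qed.

Lemma inclusion_out (la mu : intpart) (f : tens V (conjp la)) :
  mu != la -> @inclusion F V la f mu = 0.
Proof. by move=> mula; rewrite /inclusion dfwith_out // eq_sym. Qed.

Lemma Schur_bullet_inclusion (la : intpart) (f : tens V (conjp la)) :
  (size la <= \dim {:V})%N -> schurd V la f -> Schur_bullet (inclusion f).
Proof.
move=> la_le Sf; split.
- move=> mu _; have [->|mula] := eqVneq mu la; first by rewrite inclusion_in.
  by rewrite inclusion_out //; apply: schurd0.
- move=> mu mu_gt; apply: inclusion_out; apply: contraTneq mu_gt => ->.
  by rewrite -leqNgt.
- by exists [:: la] => mu; rewrite inE; apply: inclusion_out.
Qed.

Lemma geom_square_inclusion (la : intpart) (p : tens (dualv V) (conjp la))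
    (f : tens V (conjp la)) : (size la <= \dim {:V})%N -> schurd V la f ->
  geom_square la p (inclusion f) <->
  apolar f p = 0 /\ forall X, apolar (gl_actd X f) p = 0.
Proof.
move=> la_le Sf; split=> [[[_ fp] Xfp]|[fp Xfp]].
  split=> [|X]; first by rewrite -[f]inclusion_in.
  by rewrite -[f]inclusion_in.
split=> [|X mu].
  split=> [|mu]; first exact: Schur_bullet_inclusion.
  have [->|mula] := eqVneq mu la; first by rewrite inclusion_in.
  by rewrite inclusion_out // apolar0.
have [->|mula] := eqVneq mu la; first by rewrite inclusion_in.
by rewrite inclusion_out // gl_actd0 apolar0.
Qed.

Lemma geom_square_perp (la : intpart) (p : tens (dualv V) (conjp la)) :
  (size la <= \dim {:V})%N -> flag_variety V la p ->
  graded_component (geom_square la p) la = perp la (affine_tangent la p).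
Proof.
move=> la_le Pp; have [_ Sp Sext _] := flag_variety_schur Pp.
have pl := (Sext _ Sp).1.
(* For equal shapes no box is left, so the result of the action is a constant function and may be
   tested at one argument. *)
have apolar_eq0 (f : tens V (conjp la)) (x : tens (dualv V) (conjp la)) : apolar f x = 0 <->
    (\prod_(k <- conjp la) k`!%:R)^-1 * pairing f x = 0 :> F.
  rewrite apolar_self; split=> [f0|c0]; last by apply/funext => xi; apply: c0.
  exact: (congr1 (fun y : tens (dualv V) (skew_cols (conjp la) (conjp la)) => y [ffun=> 0]) f0).
have Xf_eq0 X (f : tens V (conjp la)) : schurd V la f -> apolar (gl_actd X f) p = 0 <->
    apolar f (deract (fun xi => xi \o X)%VF p) = 0.
  move=> Sf; rewrite !apolar_eq0 pairing_deract //; last exact: schurd_multilinear Sf.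
  by rewrite mulrN; split=> [/eqP|->]; rewrite ?oppr0 // oppr_eq0 => /eqP.
apply/seteqP; split=> f [Sf].
  rewrite geom_square_inclusion // => -[fp fX]; split=> // w.
  move=> /(tangent_decomposition la_le Pp)[X [d ->]].
  have /Xf_eq0 := fX X; move: fp; rewrite !apolar_eq0 pairing_comb mulrDr mulrCA.
  by move=> -> /(_ Sf) ->; rewrite mulr0 addr0.
move=> fT; split=> //; rewrite geom_square_inclusion //; split=> [|X].
  by apply: fT; apply: tangent_point.
by rewrite Xf_eq0 //; apply: fT; apply: tangent_deract.
Qed.

End GeometricSquare.

Theorem theorem3p24 (R : realType) (n : nat) (V : vectType R[i])
    (dimV : \dim {:V} = n) (la : intpart) (la_nonempty : parts la <> [::])
    (la_length : (size la < n)%N) (p : tens (dualv V) (conjp la))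
    (Pp : flag_variety V la p) :
  graded_component (geom_square la p) la = perp la (affine_tangent la p) /\
  perp la (affine_tangent la p) `<=` schurd V la.
Proof.
split; last by move=> f [].
by apply: geom_square_perp => //; rewrite dimV ltnW.
Qed.
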